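(* Let $p$ be a prime. The reduced sets for Algorithms A, B and C (the set of elements having purely periodic expansions by the respective algorithm) are given by $S$, $R$, and $P_1\cup R_1\cup S_3\cup S_4$, respectively.
   Context: Let $p$ be a prime, $v_p$ the $p$-adic additive valuation and $|\alpha|_p = p^{-v_p(\alpha)}$. Each $\alpha\in\mathbb{Q}_p$ has a unique $p$-adic expansion $\alpha=\sum_{i} e_i p^i$ with $e_i\in\{0,1,\dots,p-1\}$ and $e_i\ne 0$ for at most finitely many $i\le 0$; put $[\alpha]=\sum_{i\le 0} e_i p^i$ and $\langle\alpha\rangle=\sum_{i\ge 1}e_ip^i$, so $\alpha=[\alpha]+\langle\alpha\rangle$. Let $A_p$ be the set of elements of $p\mathbb{Z}_p$ that are algebraic over $\mathbb{Q}$ of degree at most two. The minimal polynomial of an algebraic element is its integral polynomial of lowest degree with positive leading coefficient and coprime coefficients. For $x\in A_p$ write it as $aX^2+bX+c$ if $x$ is quadratic and as $bX+c$ if $x$ is rational. For $x\in A_p\setminus\{0\}$ put $u(x)=c|c|_p\in\mathbb{Z}\setminus p\mathbb{Z}$, and define maps $T_1,T_2:A_p\setminus\{0\}\to A_p$ by $$T_1(x)=\frac{u(x)p^{v_p(x)}}{x}-d_1(x),\qquad T_2(x)=\frac{-u(x)p^{v_p(x)}}{x}-d_2(x),$$ where $d_1(x),d_2(x)\in\{1,\dots,p-1\}$ are the unique choices making $T_1(x),T_2(x)\in p\mathbb{Z}_p$. The three algorithms are given by the following maps $T:A_p\setminus\{0\}\to A_p$ (where the minimal polynomial of $x$ is $aX^2+bX+c$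 if $x$ is quadratic and $bX+c$ if $x$ is rational). Algorithm A: $T(x)=T_2(x)$. Algorithm B: $T(x)=T_2(x)$ if $b\ge 0$, and $T(x)=T_1(x)$ if $b<0$. Algorithm C: $T(x)=T_2(x)$ if $b\ge 0$ and $c>0$, and $T(x)=T_1(x)$ otherwise. For a given algorithm put $t(x)=u(x)$, $d(x)=d_1(x)$ when $T(x)$ is defined as $T_1(x)$, and $t(x)=-u(x)$, $d(x)=d_2(x)$ when $T(x)$ is defined as $T_2(x)$; thus $T(x)=t(x)p^{v_p(x)}/x-d(x)$. The expansion of $\alpha\in\mathbb{Q}_p$ (algebraic of degree at most two) by the algorithm is the continued fraction $$[\alpha]+\cfrac{t_1p^{k_1}}{d_1+\cfrac{t_2p^{k_2}}{d_2+\cfrac{t_3p^{k_3}}{\ddots}}},\qquad t_i=t(T^{i-1}(\langle\alpha\rangle)),\ k_i=v_p(T^{i-1}(\langle\alpha\rangle)),\ d_i=d(T^{i-1}(\langle\alpha\rangle)),$$ which terminates after the $N$-th term if $T^N(\langle\alpha\rangle)=0$ for some (first) $N\ge 0$, and is infinite otherwise. The expansion is purely periodic if it is infinite, $[\alpha]=0$ (so $\alpha\in p\mathbb{Z}_p$), and there is $\ell\ge1$ with $(t_{i+\ell},k_{i+\ell},d_{i+\ell})=(t_i,k_i,d_i)$ for all $i\ge 1$. The reduced set for an algorithm is the set of all elements $\alpha$ having a purely periodic expansion by that algorithm. A quadratic Hensel root is an element of $p\mathbb{Z}_p$ that is a root of an irreducible polynomial $X^2+bX+c\in\mathbb{Z}[X]$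 with $b\in\mathbb{Z}\setminus p\mathbb{Z}$ and $c\in p\mathbb{Z}$. By Hensel's Lemma such a polynomial has exactly one root in $p\mathbb{Z}_p$, and the root is identified with the pair $(b,c)$. Under this identification: $S=\{(b,c)\in\mathbb{Z}^2 : b\in\mathbb{Z}\setminus p\mathbb{Z},\ c\in p\mathbb{Z},\ X^2+bX+c \text{ irreducible}\}$ is the set of all quadratic Hensel roots; $S_1=\{(b,c)\in S: b>0,\ c>0\}$, $S_3=\{(b,c)\in S: b<0,\ c<0\}$, $S_4=\{(b,c)\in S: b>0,\ c<0\}$; $R=\{(b,c)\in S: 1\le b\le p-1\}$, $R_1=\{(b,c)\in S_1: 1\le b\le p-1\}$; $P_1=\{(b,c)\in S_1\setminus R_1 : c<[b]\langle b\rangle\}$, where $[b]=\sum_{i\le 0} e_i p^i$ and $\langle b\rangle=\sum_{i\ge 1} e_i p^i$ are the integral and fractional parts of $b$, with $b=\sum_i e_i p^i$ the $p$-adic expansion of $b$ (for a positive integer $b$ prime to $p$, $[b]\in\{1,\dots,p-1\}$ is the residue of $b$ mod $p$ and $\langle b\rangle=b-[b]$). *)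

(* Defs.v *)
From HB Require Import structures.
From mathcomp Require Import all_boot all_order all_algebra.
From mathcomp Require Import boolp classical_sets.

Set Implicit Arguments.
Unset Strict Implicit.
Unset Printing Implicit Defensive.

Import Order.TTheory GRing.Theory Num.Theory.

Local Open Scope classical_set_scope.
Local Open Scope ring_scope.

(* The ring of p-adic integers, as the inverse limit of the rings Z/p^n.  The
   class modulo p^n is represented by its canonical representative [pres x n];
   the coherence condition also forces 0 <= pres x n < p^n. *)
Record padic_int (p : nat) (p_pr : prime p) := PadicInt {
  pres :> nat -> int;
  presP : forall n, pres n = (pres n.+1 %% (p ^ n)%N)%Z
}.

HB.instance Definition _ (p : nat) (p_pr : prime p) :=
  gen_eqMixin (padic_int p_pr).
HB.instance Definition _ (p : nat) (p_pr : prime p) :=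
  gen_choiceMixin (padic_int p_pr).

Section PadicIntRing.
Context (p : nat) (p_pr : prime p).
Local Notation Zp := (padic_int p_pr).

Lemma padic_int_eqP (x y : Zp) :
  (forall n, pres x n = pres y n %[mod (p ^ n)%N])%Z -> x = y.
Proof.
move=> exy; have /funext e : pres x =1 pres y.
  by move=> n; rewrite (presP x) (presP y) -modz_mod -presP exy presP modz_mod.
case: x y e {exy} => [f fP] [g gP] /= e; case: _ / e gP => gP.
by congr PadicInt; apply: Prop_irrelevance.
Qed.

Lemma modz_pexpS (m n : nat) (k : int) : (m <= n)%N ->
  ((k %% (p ^ n)%N)%Z = k %[mod (p ^ m)%N])%Z.
Proof.
move=> le_mn; rewrite {2}(divz_eq k (p ^ n)%N).
by rewrite -(subnK le_mn) expnD PoszM mulrA modzMDl.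
Qed.

Definition coherent (g : nat -> int) :=
  forall n, (g n.+1 = g n %[mod (p ^ n)%N])%Z.

Lemma padic_lim_subproof g : coherent g -> forall n,
  (g n %% (p ^ n)%N)%Z = ((g n.+1 %% (p ^ n.+1)%N)%Z %% (p ^ n)%N)%Z.
Proof. by move=> gP n; rewrite modz_pexpS // gP. Qed.

Definition padic_lim g (gP : coherent g) : Zp :=
  PadicInt p_pr (padic_lim_subproof gP).

Lemma pres_coherent (x : Zp) : coherent x.
Proof. by move=> n; rewrite [in RHS]presP modz_mod. Qed.

Fact cst_coherent (k : int) : coherent (fun=> k).
Proof. by []. Qed.
Fact opp_coherent (x : Zp) : coherent (fun n => - x n).
Proof. by move=> n; rewrite -modzNm pres_coherent modzNm. Qed.
Fact add_coherent (x y : Zp) : coherent (fun n => x n + y n).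
Proof. by move=> n; rewrite -modzDm !pres_coherent modzDm. Qed.
Fact mul_coherent (x y : Zp) : coherent (fun n => x n * y n).
Proof. by move=> n; rewrite -modzMm !pres_coherent modzMm. Qed.

Definition padic_cst k := padic_lim (cst_coherent k).
Definition padic_opp x := padic_lim (opp_coherent x).
Definition padic_add x y := padic_lim (add_coherent x y).
Definition padic_mul x y := padic_lim (mul_coherent x y).

Fact padic_addA : associative padic_add.
Proof.
move=> x y z; apply: padic_int_eqP => n /=.
by rewrite !modz_mod modzDml modzDmr addrA.
Qed.
Fact padic_addC : commutative padic_add.
Proof. by move=> x y; apply: padic_int_eqP => n /=; rewrite addrC. Qed.
Fact padic_add0 : left_id (padic_cst 0) padic_add.
Proof.
by move=> x; apply: padic_int_eqP => n /=; rewrite modz_mod modzDml add0r.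
Qed.
Fact padic_addN : left_inverse (padic_cst 0) padic_opp padic_add.
Proof.
by move=> x; apply: padic_int_eqP => n /=; rewrite !modz_mod modzDml addNr.
Qed.

HB.instance Definition _ := GRing.isZmodule.Build Zp
  padic_addA padic_addC padic_add0 padic_addN.

Fact padic_mulA : associative padic_mul.
Proof.
move=> x y z; apply: padic_int_eqP => n /=.
by rewrite !modz_mod modzMml modzMmr mulrA.
Qed.
Fact padic_mulC : commutative padic_mul.
Proof. by move=> x y; apply: padic_int_eqP => n /=; rewrite mulrC. Qed.
Fact padic_mul1 : left_id (padic_cst 1) padic_mul.
Proof.
by move=> x; apply: padic_int_eqP => n /=; rewrite modz_mod modzMml mul1r.
Qed.
Fact padic_mulDl : left_distributive padic_mul padic_add.
Proof.
move=> x y z; apply: padic_int_eqP => n /=.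
by rewrite !modz_mod modzMml modzDm mulrDl.
Qed.
Fact padic_1neq0 : padic_cst 1 != 0.
Proof.
apply/eqP => /(congr1 (fun x : Zp => pres x 1)) /=.
by rewrite expn1 mod0z modz_small // ltz_nat prime_gt1.
Qed.

HB.instance Definition _ := GRing.Zmodule_isComNzRing.Build Zp
  padic_mulA padic_mulC padic_mul1 padic_mulDl padic_1neq0.

Definition padic_unit : {pred Zp} := fun x => `[< exists y, y * x = 1 >].
Definition padic_inv (x : Zp) : Zp :=
  if pselect (exists y, y * x = 1) is left ex then projT1 (cid ex) else x.

Fact padic_mulVx : {in padic_unit, left_inverse 1 padic_inv *%R}.
Proof.
move=> x /asboolP ex; rewrite /padic_inv.
by case: pselect => // ex'; case: (cid ex').
Qed.
Fact padic_unitPl (x y : Zp) : y * x = 1 -> padic_unit x.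
Proof. by move=> xy; apply/asboolP; exists y. Qed.
Fact padic_invr_out : {in [predC padic_unit], padic_inv =1 id}.
Proof.
move=> x /negP nx; rewrite /padic_inv; case: pselect => // ex.
by case: nx; apply/asboolP.
Qed.

HB.instance Definition _ := GRing.ComNzRing_hasMulInverse.Build Zp
  padic_mulVx padic_unitPl padic_invr_out.

Lemma pres_leq (x : Zp) (m n : nat) : (m <= n)%N ->
  (x n = x m %[mod (p ^ m)%N])%Z.
Proof.
move=> /subnK <-; elim: (n - m)%N => // k IHk.
rewrite addSn -IHk -(modz_pexpS (x (k + m).+1) (leq_addl k m)).
by rewrite pres_coherent modz_pexpS // leq_addl.
Qed.

Lemma pres_neq0 (x : Zp) : x != 0 ->
  exists m, forall n, ~~ ((p ^ m)%N %| x (m + n)%N)%Z.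
Proof.
move=> x0; apply: contrapT => /forallNP H; case/eqP: x0.
apply: padic_int_eqP => m /=; rewrite mod0z mod0z.
apply/eqP/negP => /negP xm; apply: (H m) => n.
by rewrite (sameP dvdz_mod0P eqP) pres_leq // leq_addr.
Qed.

Fact padic_integral : GRing.integral_domain_axiom Zp.
Proof.
move=> x y xy0; apply/norP => -[/pres_neq0[m xm] /pres_neq0[n yn]].
have /eqP := congr1 (fun z : Zp => z (m + n)%N) xy0.
rewrite /= mod0z (sameP eqP dvdz_mod0P); move: (xm n) (yn m).
rewrite [(n + m)%N]addnC !dvdzE abszM /=.
move: `|x _|%N `|y _|%N => a b an bn.
have a0 : (0 < a)%N by case: a an; rewrite ?dvdn0.
have b0 : (0 < b)%N by case: b bn; rewrite ?dvdn0.
move: an bn; rewrite !pfactor_dvdn ?muln_gt0 ?a0 // lognM // -!ltnNge => am bn.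
by rewrite leqNgt -addSn leq_add // ltnW.
Qed.

HB.instance Definition _ := GRing.ComUnitRing_isIntegral.Build Zp padic_integral.

End PadicIntRing.

Notation padic p_pr := {fraction (padic_int p_pr)}.

Section Padic.
Context (p : nat) (p_pr : prime p).
Local Notation Zp := (padic_int p_pr).
Local Notation Qp := (padic p_pr).

(* The fractional ideal p^k Z_p. *)
Definition pZp (k : int) : set Qp :=
  [set x | exists z : Zp, x = p%:R ^ k * tofrac z].

(* The additive valuation of a nonzero x (an arbitrary value at 0). *)
Definition vp (x : Qp) : int :=
  xget 0 [set k | pZp k x /\ ~ pZp (k + 1) x].

(* x is the sum of the convergent series with terms e_i p^i, where i >= - N. *)
Definition padic_expansion (N : nat) (e : int -> nat) (x : Qp) : Prop :=
  [/\ forall i, (e i < p)%N,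
      forall i, i < - N%:Z -> e i = 0%N
    & forall k : int, exists n0 : nat, forall n : nat, (n0 <= n)%N ->
        pZp k (x - \sum_(0 <= j < n) (e (j%:Z - N%:Z))%:R * p%:R ^ (j%:Z - N%:Z))].

(* [x] is a finite sum in Z[1/p], hence is taken in rat. *)
Definition int_part (x : Qp) : rat :=
  xget 0 [set r | exists N e, padic_expansion N e x /\
    r = \sum_(0 <= j < N.+1) (e (- j%:Z))%:R * p%:R ^ (- j%:Z)].

Definition frac_part (x : Qp) : Qp := x - ratr (int_part x).

Definition int_root (P : {poly int}) (x : Qp) : Prop :=
  root (map_poly intr P) x.

Definition is_minpoly (P : {poly int}) (x : Qp) : Prop :=
  [/\ int_root P x,
      0 < lead_coef P,
      (forall d : int, (forall i, (d %| P`_i)%Z) -> `|d| = 1)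
    & forall Q : {poly int}, Q != 0 -> int_root Q x -> (size P <= size Q)%N].

Definition minpoly (x : Qp) : {poly int} :=
  xget 0 [set P | is_minpoly P x].

Definition degree_le2 (x : Qp) : Prop :=
  exists2 P, is_minpoly P x & (size P <= 3)%N.

(* The minimal polynomial is written aX^2+bX+c for quadratic x and bX+c for
   rational x, so b and c are the coefficients of X and 1 in both cases. *)
Definition bcoef (x : Qp) : int := (minpoly x)`_1.
Definition ccoef (x : Qp) : int := (minpoly x)`_0.

(* u(x) = c |c|_p, where the division is exact. *)
Definition ucoef (x : Qp) : int :=
  (ccoef x %/ (p ^ logn p `|ccoef x|)%N)%Z.

(* The d in {1, ..., p-1} with y - d in pZ_p. *)
Definition digit_for (y : Qp) : nat :=
  xget 0%N [set d | (0 < d < p)%N /\ pZp 1 (y - d%:R)].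

Definition quot1 (x : Qp) : Qp := (ucoef x)%:~R * p%:R ^ vp x / x.
Definition quot2 (x : Qp) : Qp := - (ucoef x)%:~R * p%:R ^ vp x / x.

Definition d1 (x : Qp) : nat := digit_for (quot1 x).
Definition d2 (x : Qp) : nat := digit_for (quot2 x).

Definition T1 (x : Qp) : Qp := quot1 x - (d1 x)%:R.
Definition T2 (x : Qp) : Qp := quot2 x - (d2 x)%:R.

End Padic.

Variant algorithm := AlgA | AlgB | AlgC.

Section Expansions.
Context (p : nat) (p_pr : prime p) (alg : algorithm).
Local Notation Qp := (padic p_pr).

Definition uses_T2 (x : Qp) : bool :=
  match alg with
  | AlgA => true
  | AlgB => 0 <= bcoef x
  | AlgC => (0 <= bcoef x) && (0 < ccoef x)
  end.

Definition cfT (x : Qp) : Qp := if uses_T2 x then T2 x else T1 x.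
Definition cft (x : Qp) : int := if uses_T2 x then - ucoef x else ucoef x.
Definition cfd (x : Qp) : nat := if uses_T2 x then d2 x else d1 x.

(* T is only meaningful away from 0: the iterates past a first zero are junk,
   and are excluded by [infinite_expansion]. *)
Definition cf_iter (x : Qp) (i : nat) : Qp := iter i cfT (frac_part x).

(* The triple (t_(i+1), k_(i+1), d_(i+1)). *)
Definition cf_term (x : Qp) (i : nat) : int * int * nat :=
  (cft (cf_iter x i), vp (cf_iter x i), cfd (cf_iter x i)).

Definition infinite_expansion (x : Qp) : Prop :=
  forall n, cf_iter x n != 0.

Definition purely_periodic (x : Qp) : Prop :=
  [/\ infinite_expansion x,
      int_part x = 0
    & exists2 l, (0 < l)%N & forall i, cf_term x (i + l) = cf_term x i].

Definition reduced_set : set Qp :=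
  [set x | degree_le2 x /\ purely_periodic x].

End Expansions.

Section Hensel.
Context (p : nat) (p_pr : prime p).
Local Notation Qp := (padic p_pr).

Definition hensel_poly (b c : int) : {poly int} := 'X^2 + b *: 'X + c%:P.

(* For this monic polynomial, irreducibility in Z[X] and Q[X] coincide. *)
Definition setS : set (int * int) :=
  [set bc | [/\ ~~ (p %| bc.1)%Z, (p %| bc.2)%Z &
     irreducible_poly (map_poly (intr : int -> rat) (hensel_poly bc.1 bc.2))]].

Definition setS1 : set (int * int) := setS `&` [set bc | 0 < bc.1 /\ 0 < bc.2].
Definition setS3 : set (int * int) := setS `&` [set bc | bc.1 < 0 /\ bc.2 < 0].
Definition setS4 : set (int * int) := setS `&` [set bc | 0 < bc.1 /\ bc.2 < 0].

Definition setR : set (int * int) :=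
  setS `&` [set bc | 1 <= bc.1 <= p%:Z - 1].
Definition setR1 : set (int * int) :=
  setS1 `&` [set bc | 1 <= bc.1 <= p%:Z - 1].

(* For an integer b, both [b] and <b> = b - [b] are rational numbers. *)
Definition setP1 : set (int * int) :=
  (setS1 `\` setR1) `&`
  [set bc | let ib := int_part (bc.1%:~R : Qp) in
            bc.2%:~R < ib * (bc.1%:~R - ib)].

(* The quadratic Hensel roots identified with the pairs in E. *)
Definition hensel_roots (E : set (int * int)) : set Qp :=
  [set x | pZp 1 x /\ exists2 bc, E bc & int_root (hensel_poly bc.1 bc.2) x].

End Hensel.

Arguments reduced_set {p} p_pr alg _.
Arguments hensel_roots {p} p_pr E _.
Arguments setP1 {p} p_pr _.

(* Main.v *)
Require Import Defs.
From mathcomp Require Import all_boot all_order all_algebra.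
From mathcomp Require Import boolp classical_sets.
From mathcomp Require Import ring lra zify.

(* On Hensel roots, identified with pairs (b, c), T_2 acts as the involution
   (b, c) |-> (2d - b, c - d (b - d)), where d is the residue of b modulo p, and
   T_1 is T_2 composed with (b, c) |-> (-b, c); both preserve b^2 - 4c.  A Hensel
   root is determined by (b, c), so its expansion is purely periodic as soon as
   (b, c) is periodic under this integer dynamics.

   Conversely, T is contracting in the p-adic metric, so an element x with l-periodic
   terms satisfies T^l x = x.  Multiplying the recurrences x_i (x_(i+1) + d_i) =
   t_i p^(k_i) gives x (C x + E) = A x + B with A, B divisible by p and E prime to
   p; hence the middle coefficient of the minimal polynomial of x is prime to p.
   Then T x, and therefore x = T^(l-1) (T x), is a Hensel root, unless x is
   rational, in which case its expansion terminates.

   It remains to find the periodic pairs.  For A all pairs have period 2; for B the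
   pairs of R are fixed, and outside R the value |b| decreases until R is reached.
   For C the reduced set is stable, |b| decreases outside of it until it is reached,
   and on it T is injective with finite orbits, since b^2 - 4c is invariant. *)

Set Implicit Arguments.
Unset Strict Implicit.
Unset Printing Implicit Defensive.

Import Order.TTheory GRing.Theory Num.Theory.

Local Open Scope classical_set_scope.
Local Open Scope ring_scope.

(** * p-adic integers and numbers *)

Section PadicIntegers.
Context (p : nat) (p_pr : prime p).
Local Notation Zp := (padic_int p_pr).
Implicit Types (z : Zp) (n m : nat) (k : int).

Let pexp_gt0 n : (0 : int) < (p ^ n)%N.
Proof. by rewrite ltz_nat expn_gt0 prime_gt0. Qed.

Let pexp_neq0 n : ((p ^ n)%N : int) != 0.
Proof. by rewrite gt_eqF. Qed.

Lemma pres_bound z n : 0 <= pres z n < (p ^ n)%N.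
Proof. by rewrite presP modz_ge0 // ltz_pmod. Qed.

Lemma presM z1 z2 n : pres (z1 * z2) n = ((pres z1 n * pres z2 n) %% (p ^ n)%N)%Z.
Proof. by []. Qed.

Lemma presD z1 z2 n : pres (z1 + z2) n = ((pres z1 n + pres z2 n) %% (p ^ n)%N)%Z.
Proof. by []. Qed.

Lemma presN z n : pres (- z) n = ((- pres z n) %% (p ^ n)%N)%Z.
Proof. by []. Qed.

Lemma pres_intr k n : pres (k%:~R : Zp) n = (k %% (p ^ n)%N)%Z.
Proof.
elim/int_ind: k => [|k IHk|k IHk]; first by rewrite mod0z /= mod0z.
  by rewrite intS intrD presD IHk mulr1z [pres 1 n]/= modzDm.
by rewrite intS opprD intrD presD IHk mulrN1z presN [pres 1 n]/= modzNm modzDm.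
Qed.

Lemma pres_natr m n : pres (m%:R : Zp) n = (m %% p ^ n)%N.
Proof. by rewrite pmulrn pres_intr modz_nat. Qed.

Lemma pexpz_natr n : (p%:R : Zp) ^+ n = (p ^ n)%:R.
Proof. by rewrite natrX. Qed.

(** The residues of [z] at [n + m], divided by [p ^ n], form a coherent sequence and so define the
    quotient. The clause on the residues of [y] lets [padic_decomp] see that its cofactor is nonzero
    modulo p. *)
Lemma pres_eq0_dvd z n : pres z n = 0 ->
  exists y, z = p%:R ^+ n * y /\
            forall m, (pres z (n + m) = (p ^ n)%N%:Z * pres y m)%Z.
Proof.
move=> zn0.
have dvd m : ((p ^ n)%N %| pres z (n + m))%Z.
  by apply/dvdz_mod0P; rewrite pres_leq ?leq_addr // zn0 mod0z.
pose g m := (pres z (n + m) %/ (p ^ n)%N)%Z.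
have gE m : pres z (n + m) = g m * (p ^ n)%N by rewrite divzK.
have gP : coherent p g.
  move=> m; apply/eqP; rewrite eqz_mod_dvd -(dvdz_mul2r (pexp_neq0 n)).
  rewrite mulrBl -!gE -PoszM -expnD [(m + n)%N]addnC -eqz_mod_dvd addnS.
  by rewrite pres_coherent.
exists (padic_lim p_pr gP); split; last first.
  move=> m; rewrite gE mulrC; congr (_ * _) => /=.
  rewrite modz_small //; have := pres_bound z (n + m); rewrite gE expnD.
  by rewrite pmulr_lge0 // [(p ^ n * _)%N]mulnC PoszM ltr_pM2r.
apply: padic_int_eqP => m.
rewrite pexpz_natr presM modz_mod pres_natr /= modzMmr -modz_nat modzMml.
rewrite mulrC -gE addnC; apply/esym/pres_leq.
exact: leq_addr.
Qed.

(** Since [n < p ^ n], the residue of [n] modulo [p ^ n] is [n] itself. *)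
Lemma padic_nat_neq0 n : (0 < n)%N -> (n%:R : Zp) != 0.
Proof.
move=> n0; apply/eqP => /(congr1 (fun z : Zp => pres z n)).
rewrite pres_natr /= mod0z modn_small; first by lia.
exact/ltn_expl/prime_gt1.
Qed.

Lemma padic_intr_eq0 k : ((k%:~R : Zp) == 0) = (k == 0).
Proof.
apply/eqP/eqP => [|-> //]; case: k => n.
  by case: n => // n; move/eqP; rewrite (negPf (padic_nat_neq0 _)).
by rewrite NegzE rmorphN /= => /eqP; rewrite oppr_eq0 (negPf (padic_nat_neq0 _)).
Qed.

Lemma dvd_presP z n : reflect (exists y, z = p%:R ^+ n * y) (pres z n == 0).
Proof.
apply: (iffP eqP) => [/pres_eq0_dvd[y [-> _]]|[y ->]]; first by exists y.
by rewrite pexpz_natr presM pres_natr modnn mul0r mod0z.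
Qed.

Lemma padic_decomp z : z != 0 ->
  exists n y, z = p%:R ^+ n * y /\ pres y 1 != 0.
Proof.
move=> z0; have ex : exists n, pres z n != 0.
  apply: contrapT => /forallNP H; case/eqP: z0; apply: padic_int_eqP => n.
  by have /negP := H n; rewrite negbK => /eqP -> /=; rewrite !mod0z.
(* The residue at index 0 is taken modulo 1 and vanishes, so the first nonzero one has an index
   [n.+1], and exactly [p ^ n] splits off. *)
have [n zn min] := ex_minnP ex; case: n => [|n] in zn min.
  by move: zn; rewrite presP expn0 modz1.
have zn0 : pres z n = 0.
  by apply/eqP; apply: contraT => /min; rewrite ltnn.
have [y [zE yE]] := pres_eq0_dvd zn0; exists n, y; split => //.
by apply: contra zn => /eqP y0; rewrite -addn1 yE y0 mulr0.
Qed.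

(** Bezout coefficients invert the residues modulo each [p ^ n]; uniqueness of inverses modulo
    [p ^ n] makes them coherent. *)
Lemma pres1_unit z : pres z 1 != 0 -> exists y, y * z = 1.
Proof.
move=> z1.
have cop n : coprimez (pres z n) (p ^ n)%N.
  case: n => [|n]; first by rewrite /coprimez expn0 gcdz1.
  rewrite coprimezE /= coprime_pexpr // coprime_sym prime_coprime //.
  apply: contra z1 => d.
  have /dvdz_mod0P : ((p : int) %| pres z n.+1)%Z by rewrite dvdzE.
  have := @pres_leq _ p_pr z 1 n.+1 isT; rewrite expn1 => -> e.
  rewrite -[X in _ == X]e.
  by rewrite modz_small //; have := pres_bound z 1; rewrite expn1.
pose g n := (egcdz (pres z n) (p ^ n)%N).1.
have gP n : (g n * pres z n = 1 %[mod (p ^ n)%N])%Z.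
  rewrite /g; case: egcdzP => u v uv _ /=.
  rewrite -(eqP (cop n)) -uv addrC; apply/esym; exact: modzMDl.
have gC : coherent p g.
  move=> n; apply/eqP; rewrite eqz_mod_dvd.
  rewrite -(@Gauss_dvdzl _ _ (pres z n)) 1?coprimez_sym // mulrBl -eqz_mod_dvd.
  rewrite gP; apply/eqP.
  have e : (pres z n.+1 = pres z n %[mod (p ^ n)%N])%Z by rewrite pres_coherent.
  rewrite -modzMmr -e modzMmr.
  by rewrite -(modz_pexpS p _ (leqnSn n)) gP modz_pexpS.
exists (padic_lim p_pr gC); apply: padic_int_eqP => n.
by rewrite presM /= !modz_mod modzMml gP.
Qed.

End PadicIntegers.

Lemma fraction_ratio (R : idomainType) (x : {fraction R}) :
  exists a b : R, b != 0 /\ x = FracField.tofrac a / FracField.tofrac b.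
Proof.
elim/quotW: x => r; have r0 := denom_ratioP r; exists r.1, r.2; split=> //.
apply: (canRL (mulfK _)); first by rewrite tofrac_eq0.
unlock FracField.tofrac; rewrite -[LHS]FracField.pi_mul.
apply/eqmodP/eqP => /=.
by rewrite /FracField.mulf /= !numden_Ratio ?mulf_neq0 ?oner_neq0 // !mulr1 mulrC.
Qed.

(** * The filtration of Q_p by the ideals p^k Z_p, units and valuations *)

Section PadicNumbers.
Context (p : nat) (p_pr : prime p).
Local Notation Zp := (padic_int p_pr).
Local Notation Qp := (padic p_pr).
Local Notation tofrac := (@FracField.tofrac Zp).
Implicit Types (x y : Qp) (z : Zp) (n m : nat) (k l : int).

Lemma padicq_intr_eq0 k : ((k%:~R : Qp) == 0) = (k == 0).
Proof. by rewrite -[k%:~R](rmorph_int tofrac) tofrac_eq0 padic_intr_eq0. Qed.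

Lemma padicq_p_neq0 : (p%:R : Qp) != 0.
Proof. by rewrite pmulrn padicq_intr_eq0; have := prime_gt0 p_pr; case: p. Qed.
Local Hint Resolve padicq_p_neq0 : core.

Lemma padicq_pX_neq0 k : (p%:R : Qp) ^ k != 0.
Proof. exact: expfz_neq0. Qed.
Local Hint Resolve padicq_pX_neq0 : core.

Lemma tofrac_pX n : tofrac (p%:R ^+ n) = p%:R ^ n.
Proof. by rewrite rmorphXn /= rmorph_nat. Qed.

Lemma pZp0 k : pZp k (0 : Qp).
Proof. by exists 0; rewrite rmorph0 mulr0. Qed.

Lemma pZp_tofrac z : pZp 0 (tofrac z).
Proof. by exists z; rewrite expr0z mul1r. Qed.

Lemma pZpD k x y : pZp k x -> pZp k y -> pZp k (x + y).
Proof. by move=> [z ->] [w ->]; exists (z + w); rewrite rmorphD mulrDr. Qed.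

Lemma pZpN k x : pZp k x -> pZp k (- x).
Proof. by move=> [z ->]; exists (- z); rewrite rmorphN mulrN. Qed.

Lemma pZpB k x y : pZp k x -> pZp k y -> pZp k (x - y).
Proof. by move=> kx ky; apply: pZpD => //; apply: pZpN. Qed.

Lemma pZpM k l x y : pZp k x -> pZp l y -> pZp (k + l) (x * y).
Proof.
by move=> [z ->] [w ->]; exists (z * w); rewrite rmorphM mulrACA -expfzDr.
Qed.

Lemma pZpW k l x : k <= l -> pZp l x -> pZp k x.
Proof.
rewrite -subr_ge0 => kl [z ->]; exists (p%:R ^+ `|l - k|%N * z).
rewrite rmorphM /= tofrac_pX gez0_abs // mulrA -expfzDr //.
by congr (_ ^ _ * _); ring.
Qed.

Lemma pZpX k : pZp k (p%:R ^ k : Qp).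
Proof. by exists 1; rewrite rmorph1 mulr1. Qed.

Lemma pZp_intr k : pZp 0 (k%:~R : Qp).
Proof. by rewrite -[k%:~R](rmorph_int tofrac); apply: pZp_tofrac. Qed.

Lemma pZpMl x y k : pZp 0 x -> pZp k y -> pZp k (x * y).
Proof. by move=> x0 yk; rewrite -[k]add0r; apply: pZpM. Qed.

Lemma pZp_sum k (I : Type) (r : seq I) (P : pred I) (F : I -> Qp) :
  (forall i, P i -> pZp k (F i)) -> pZp k (\sum_(i <- r | P i) F i).
Proof. by move=> FP; elim/big_ind: _ => //; [exact: pZp0 | exact: pZpD]. Qed.

Lemma pZp_tofracP n z : pZp n (tofrac z) <-> pres z n = 0.
Proof.
split=> [[w /eqP]|/eqP/dvd_presP[w ->]]; last first.
  by exists w; rewrite rmorphM /= tofrac_pX.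
rewrite -tofrac_pX -rmorphM tofrac_eq => /eqP ->.
by apply/eqP/dvd_presP; exists w.
Qed.

Lemma pZp_intrP n k : pZp n (k%:~R : Qp) <-> ((p ^ n)%N %| k)%Z.
Proof.
rewrite -[k%:~R](rmorph_int tofrac) pZp_tofracP pres_intr.
by split=> [/dvdz_mod0P|/dvdz_mod0P].
Qed.

Lemma pZp1_intrP k : pZp 1 (k%:~R : Qp) <-> (p %| k)%Z.
Proof. by rewrite (pZp_intrP 1) expn1. Qed.

Lemma pZp_shift k l x : pZp (k + l) (p%:R ^ k * x) -> pZp l x.
Proof.
move=> [z]; rewrite expfzDr // -mulrA => /(mulfI (padicq_pX_neq0 _)) ->.
by exists z.
Qed.

Lemma pZp_pXM k x : pZp 0 x -> pZp k (p%:R ^ k * x).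
Proof. by move=> x0; have := pZpM (pZpX k) x0; rewrite addr0. Qed.

(** The units of Z_p seen inside Q_p, expressed through the filtration. *)
Definition padicq_unit x := pZp 0 x /\ ~ pZp 1 x.

Lemma padicq_unit_neq0 x : padicq_unit x -> x != 0.
Proof. by move=> [_ x1]; apply/eqP => x0; case: x1; rewrite x0; apply: pZp0. Qed.

Lemma padicq_unitP x : padicq_unit x ->
  exists z, x = tofrac z /\ exists w : Zp, w * z = 1.
Proof.
case=> -[z]; rewrite expr0z mul1r => -> nz; exists z; split=> //.
by apply: pres1_unit; apply/eqP => z1; case: nz; apply/(pZp_tofracP 1).
Qed.

Lemma pZp_mulr_unit k x y : padicq_unit y -> pZp k (x * y) -> pZp k x.
Proof.
move=> /padicq_unitP[z [-> [w wz]]] xz.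
have -> : x = tofrac w * (x * tofrac z).
  by rewrite mulrCA -rmorphM wz rmorph1 mulr1.
by apply: pZpMl => //; apply: pZp_tofrac.
Qed.

Lemma padicq_unitM x y : padicq_unit x -> padicq_unit y -> padicq_unit (x * y).
Proof.
move=> xu yu; split; first by apply: pZpMl; [case: xu | case: yu].
by move=> /(pZp_mulr_unit yu); case: xu.
Qed.

Lemma padicq_unit1 : padicq_unit 1.
Proof.
split; first exact: (pZp_intr 1).
by move/(pZp1_intrP 1); rewrite dvdz1 => /eqP p1; have := prime_gt1 p_pr; lia.
Qed.

Lemma padicq_unitV x : padicq_unit x -> padicq_unit x^-1.
Proof.
move=> xu; have x0 := padicq_unit_neq0 xu; split.
  apply: (pZp_mulr_unit xu); rewrite mulVf //.
  by have [] := padicq_unit1.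
move=> x1; have [_] := padicq_unit1; apply.
by rewrite -(mulfV x0); apply: pZpMl => //; case: xu.
Qed.

Lemma padicq_unitD x y : padicq_unit x -> pZp 1 y -> padicq_unit (x + y).
Proof.
move=> [x0 x1] y1; split; first by apply: pZpD => //; apply: pZpW y1.
by move=> xy1; apply: x1; rewrite -(addrK y x); apply: pZpB.
Qed.

Lemma padicq_unitN x : padicq_unit x -> padicq_unit (- x).
Proof.
move=> [x0 x1]; split; first exact: pZpN.
by move/pZpN; rewrite opprK.
Qed.

Lemma padicq_unit_intr k : ~~ (p %| k)%Z -> padicq_unit k%:~R.
Proof.
by move=> nk; split; [exact: pZp_intr | move/pZp1_intrP; apply/negP].
Qed.

(** If [l < k], dividing by [p ^ l] would put the unit [w] into p Z_p. *)
Lemma pZp_pX_unit k l w : padicq_unit w -> pZp k (p%:R ^ l * w) -> k <= l.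
Proof.
move=> [_ w1] kl; rewrite leNgt; apply/negP => lk; apply: w1.
by apply: (@pZp_shift l); apply: pZpW kl; lia.
Qed.

Lemma padicq_decomp x : x != 0 ->
  exists k w, padicq_unit w /\ x = p%:R ^ k * w.
Proof.
have dec z : z != 0 -> exists n w, padicq_unit w /\ tofrac z = p%:R ^ (n : int) * w.
  case/padic_decomp => n [y [-> y1]]; exists n, (tofrac y).
  rewrite rmorphM /= tofrac_pX; split=> //; split; first exact: pZp_tofrac.
  by move/(pZp_tofracP 1) => e; rewrite e eqxx in y1.
have [a [b [b0 ->]]] := fraction_ratio x; have [->|a0 _] := eqVneq a 0.
  by rewrite rmorph0 mul0r eqxx.
have [m [v [uv ->]]] := dec _ a0; have [n [w [uw ->]]] := dec _ b0.
exists (m%:Z - n%:Z), (v / w); split.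
  by apply: padicq_unitM => //; apply: padicq_unitV.
by rewrite expfzDr // invfM -invr_expz; ring.
Qed.

Lemma vpE k w : padicq_unit w -> vp (p%:R ^ k * w) = k.
Proof.
move=> wu; rewrite /vp; case: xgetP => [l _ [kl kl1]|/(_ k)[]].
  have lk := pZp_pX_unit wu kl; apply/eqP; rewrite eq_le lk leNgt.
  apply/negP => lt; apply: kl1; apply: (@pZpW _ k); first lia.
  by apply: pZp_pXM; case: wu.
split; last by move/(pZp_pX_unit wu); lia.
by apply: pZp_pXM; case: wu.
Qed.

Lemma pZp_small x : (forall n : nat, pZp n x) -> x = 0.
Proof.
move=> H; apply/eqP; apply: contraT => /padicq_decomp[k [w [wu xE]]].
have := H (absz (k + 1)); rewrite xE => /(pZp_pX_unit wu); lia.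
Qed.

End PadicNumbers.

(** * Digit expansions and integral parts *)

Section Expansion.
Context (p : nat) (p_pr : prime p).
Local Notation Zp := (padic_int p_pr).
Local Notation Qp := (padic p_pr).
Local Notation tofrac := (@FracField.tofrac Zp).
Implicit Types (x y : Qp) (z : Zp) (n m : nat) (k l : int).

Let pexp_gt0 n : (0 : int) < (p ^ n)%N.
Proof. by rewrite ltz_nat expn_gt0 prime_gt0. Qed.

Lemma digit_sum_lt (f : nat -> nat) n : (forall j, f j < p)%N ->
  (\sum_(0 <= j < n) f j * p ^ j < p ^ n)%N.
Proof.
move=> fp; elim: n => [|n IHn]; first by rewrite big_geq.
rewrite big_nat_recr //= expnS; have := fp n; move: IHn.
by move: (\sum_(_ <= _ < _) _)%N (p ^ n)%N (f n) => s q d; nia.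
Qed.

Lemma digit_sum_shift (F : fieldType) (f : nat -> nat) (N n : nat) :
  (p%:R : F) != 0 ->
  \sum_(0 <= j < n) (f j)%:R * (p%:R : F) ^ (j%:Z - N%:Z) =
  (\sum_(0 <= j < n) f j * p ^ j)%N%:R * p%:R ^ (- N%:Z).
Proof.
move=> p0; rewrite natr_sum mulr_suml; apply: eq_bigr => j _.
by rewrite expfzDr // mulrA natrM natrX.
Qed.

Definition padic_digit z n : nat := `|(pres z n.+1 %/ (p ^ n)%N)%Z|%N.

Lemma padic_digitE z n :
  pres z n.+1 = (padic_digit z n)%:Z * (p ^ n)%N + pres z n.
Proof.
rewrite {1}(divz_eq (pres z n.+1) (p ^ n)%N) -presP gez0_abs //.
by rewrite divz_ge0 //; have /andP[] := pres_bound z n.+1.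
Qed.

Lemma padic_digit_lt z n : (padic_digit z n < p)%N.
Proof.
have /andP[_] := pres_bound z n.+1; rewrite padic_digitE expnS.
have /andP[] := pres_bound z n; have := pexp_gt0 n.
move: (padic_digit z n) (pres z n) (p ^ n)%N => d a q.
by nia.
Qed.

Lemma padic_digit_sum z n :
  (\sum_(0 <= j < n) padic_digit z j * p ^ j)%N%:Z = pres z n.
Proof.
elim: n => [|n IHn]; first by rewrite big_geq // presP modz1.
by rewrite big_nat_recr //= PoszD IHn padic_digitE addrC PoszM.
Qed.

Lemma padic_expansion_exists x : exists N e, padic_expansion N e x.
Proof.
have [N [z ->]] : exists (N : nat) z, x = p%:R ^ (- N%:Z) * tofrac z.
  have [->|/padicq_decomp[k [w [wu ->]]]] := eqVneq x 0.
    by exists 0%N, 0; rewrite rmorph0 mulr0.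
  have [z [-> _]] := padicq_unitP wu.
  (* With [N = |k|] the exponent [k + N] is nonnegative whatever the sign of [k], so [p ^ N x] is a
     p-adic integer. *)
  exists (absz k), (p%:R ^+ absz (k + (absz k)%:Z) * z).
  have e : (absz (k + (absz k)%:Z))%:Z = k + (absz k)%:Z by lia.
  rewrite rmorphM /= tofrac_pX e mulrA -expfzDr ?padicq_p_neq0 //.
  by rewrite addrCA addNr addr0.
exists N, (fun i => if (i + N%:Z)%R is Posz m then padic_digit z m else 0%N).
split.
- by move=> i; case: (i + _) => m; rewrite ?padic_digit_lt ?prime_gt0.
- move=> i; rewrite -subr_lt0 opprK.
  by case: (i + _).
move=> k; exists (absz (k + N%:Z)) => n kn.
under eq_bigr => j _ do rewrite subrK /=.
rewrite (digit_sum_shift (padic_digit z)) ?padicq_p_neq0 //.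
rewrite [X in _ - X]mulrC -mulrBr [X in _ - X]pmulrn padic_digit_sum.
apply: (@pZpW _ _ _ (- N%:Z + n%:Z)).
  lia.
apply: pZpM; first exact: pZpX.
rewrite -[(pres z n)%:~R](rmorph_int tofrac) -rmorphB; apply/pZp_tofracP.
rewrite presD presN pres_intr modzDmr.
rewrite (modz_small (pres_bound z n)) subrr; exact: mod0z.
Qed.

(** The [N.+1] digits of index at most 0 assemble into one integer [s] over [p ^ N], and all later
    terms lie in p Z_p. The integer [s] links the sum, taken in [rat], with the congruence in
    Q_p. *)
Lemma padic_expansion_value N e x : padic_expansion N e x ->
  exists2 s : int, 0 <= s < (p ^ N.+1)%N &
    \sum_(0 <= j < N.+1) (e (- j%:Z))%:R * (p%:R : rat) ^ (- j%:Z) =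
      s%:~R * p%:R ^ (- N%:Z) /\ pZp 1 (x - s%:~R * p%:R ^ (- N%:Z)).
Proof.
move=> [ep _ /(_ 1)[n0 Hn0]].
pose f j := e (j%:Z - N%:Z).
exists (\sum_(0 <= j < N.+1) f j * p ^ j)%N%:Z.
  by rewrite ltz_nat digit_sum_lt // => j; apply: ep.
rewrite -!pmulrn -!digit_sum_shift ?padicq_p_neq0 //; last first.
  by rewrite pnatr_eq0 -lt0n prime_gt0.
split.
  rewrite big_nat_rev /=; apply: eq_big_nat => j /andP[_ jN].
  by rewrite /f add0n subSS -!subzn // opprB.
(* Enough terms both to approximate [x] modulo p and to include every index up to 0. *)
have := Hn0 (maxn n0 N.+1) (leq_maxl _ _).
rewrite (big_cat_nat (leq0n _) (leq_maxr n0 N.+1)) /= opprD addrA.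
move=> h; rewrite -[X in pZp 1 X](subrK (\sum_(N.+1 <= j < maxn n0 N.+1)
   (e (j%:Z - N%:Z))%:R * p%:R ^ (j%:Z - N%:Z))).
apply: pZpD h _; rewrite big_nat; apply: pZp_sum => j /andP[Nj _].
apply: pZpMl; first by rewrite pmulrn; apply: pZp_intr.
by apply: (@pZpW _ _ _ (j%:Z - N%:Z)); [lia | exact: pZpX].
Qed.

Lemma int_partP x : exists N (s : int), [/\ 0 <= s < (p ^ N.+1)%N,
  int_part x = s%:~R * p%:R ^ (- N%:Z) & pZp 1 (x - s%:~R * p%:R ^ (- N%:Z))].
Proof.
rewrite /int_part; case: xgetP => [r _ [N [e [ex ->]]]|H].
  have [s s_bound [-> sx]] := padic_expansion_value ex.
  by exists N, s.
have [N [e ex]] := padic_expansion_exists x.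
by case: (H (\sum_(0 <= j < N.+1) (e (- j%:Z))%:R * p%:R ^ (- j%:Z))); exists N, e.
Qed.

Lemma int_part_eq0 x : int_part x = 0 -> pZp 1 x.
Proof.
have [N [s [_ -> sx]]] := int_partP x => /eqP.
rewrite mulf_eq0 intr_eq0 expfz_eq0 pnatr_eq0 (gtn_eqF (prime_gt0 p_pr)) andbF orbF.
by move=> /eqP s0; move: sx; rewrite s0 mul0r subr0.
Qed.

(** Write the integral part as [s / p ^ N]. Both [s] and [k p ^ N] are nonnegative, less than
    [p ^ N.+1] and congruent modulo [p ^ N.+1], hence equal. *)
Lemma int_partE x k : 0 <= k < p%:Z -> pZp 1 (x - k%:~R) -> int_part x = k%:~R.
Proof.
move=> k_bound xk; have [N [s [s_bound -> sx]]] := int_partP x.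
suff -> : s = k * (p ^ N)%N.
  rewrite rmorphM /= -pmulrn natrX -exprnN mulfK // expf_neq0 //.
  by rewrite pnatr_eq0 (gtn_eqF (prime_gt0 p_pr)).
have h : pZp 1 (s%:~R * p%:R ^ (- N%:Z) - k%:~R : Qp).
  rewrite (_ : _ - _ = (x - k%:~R) - (x - s%:~R * p%:R ^ (- N%:Z))).
    exact: pZpB.
  by rewrite opprB [RHS]addrC subrKA.
have {h} : pZp N.+1 ((s - k * (p ^ N)%N)%:~R : Qp).
  have -> : (s - k * (p ^ N)%N)%:~R =
      p%:R ^ N%:Z * (s%:~R * p%:R ^ (- N%:Z) - k%:~R) :> Qp.
    rewrite mulrBr mulrCA -expfzDr ?padicq_p_neq0 // subrr mulr1.
    by rewrite rmorphB rmorphM /= -pmulrn natrX mulrC.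
  have := pZpM (pZpX p_pr N%:Z) h.
  by rewrite (_ : N%:Z + 1 = N.+1%:Z) //; lia.
move/pZp_intrP; move: k_bound s_bound; rewrite expnS PoszM.
move=> /andP[k0 kp] /andP[s0 sp] /dvdzP[q E]; move: s0 sp E (pexp_gt0 N).
move: ((p ^ N)%N : int) => Q s0 sp E Q0.
have q0 : q = 0 by apply/eqP; nia.
by move: E; rewrite q0 mul0r => /eqP; rewrite subr_eq0 => /eqP.
Qed.

End Expansion.

(** * Minimal polynomials *)

(** The content is positive and divides every coefficient, so coprimality makes it 1. *)
Lemma zprimitive_of_coprime (P : {poly int}) : 0 < lead_coef P ->
  (forall d : int, (forall i, (d %| P`_i)%Z) -> `|d| = 1) -> zprimitive P = P.
Proof.
move=> lcP prim; rewrite [RHS]zpolyEprim.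
have c0 : 0 < zcontents P by rewrite -sgz_gt0 sgz_contents sgz_gt0.
have := dvdzz (zcontents P); rewrite dvdz_contents => /polyOverP /prim.
by rewrite gtr0_norm // => ->; rewrite scale1r.
Qed.

Lemma root_intr_comb (F : fieldType) (P Q : {poly int}) (a b : int) (x : F) :
  root (map_poly intr P) x -> root (map_poly intr Q) x ->
  root (map_poly intr (a *: Q - b *: P)) x.
Proof.
move=> /rootP Px /rootP Qx; apply/rootP.
by rewrite rmorphB /= !map_polyZ hornerD hornerN !hornerZ Px Qx !mulr0 subr0.
Qed.

Section Minpoly.
Context (p : nat) (p_pr : prime p).
Local Notation Zp := (padic_int p_pr).
Local Notation Qp := (padic p_pr).
Implicit Types (x y : Qp) (P Q : {poly int}) (a b c : int).

Lemma int_root_size3 P x : (size P <= 3)%N ->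
  int_root P x <-> (P`_2)%:~R * x ^+ 2 + (P`_1)%:~R * x + (P`_0)%:~R = 0.
Proof.
move=> P3; rewrite /int_root /root (@horner_coef_wide _ 3); last first.
  by rewrite (leq_trans (size_poly _ _)).
rewrite !big_ord_recl big_ord0 /= !coef_map /=.
rewrite [X in X == 0](_ : _ =
  (P`_2)%:~R * x ^+ 2 + (P`_1)%:~R * x + (P`_0)%:~R).
  by split=> [/eqP//|->].
rewrite /bump /= !add1n.
by move: (P`_0)%:~R (P`_1)%:~R (P`_2)%:~R => c b a; ring.
Qed.

(** Phrased through integer linear relations because these are what elimination between two
    quadratic relations produces. *)
Definition irrational x := forall e f : int, e%:~R * x + f%:~R = 0 -> e = 0.

Definition quad_poly a b c : {poly int} := a *: 'X^2 + b *: 'X + c%:P.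

Lemma quad_polyE a b c :
  [/\ (quad_poly a b c)`_2 = a, (quad_poly a b c)`_1 = b & (quad_poly a b c)`_0 = c].
Proof.
by rewrite /quad_poly !coefD !coefZ !coefXn !coefX !coefC /=
  !(mulr0, mulr1, addr0, add0r).
Qed.

Lemma quad_poly_coef_ge3 a b c i : (2 < i)%N -> (quad_poly a b c)`_i = 0.
Proof.
case: i => [|[|[|i]]] // _.
by rewrite /quad_poly !coefD !coefZ !coefXn !coefX !coefC /= !(mulr0, addr0).
Qed.

Lemma size_quad_poly a b c : (size (quad_poly a b c) <= 3)%N.
Proof. by apply/leq_sizeP => j; exact: quad_poly_coef_ge3. Qed.

Lemma quad_poly_root a b c x :
  int_root (quad_poly a b c) x <-> a%:~R * x ^+ 2 + b%:~R * x + c%:~R = 0.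
Proof.
by rewrite int_root_size3 ?size_quad_poly //; have [-> -> ->] := quad_polyE a b c.
Qed.

Lemma hensel_polyE b c : hensel_poly b c = quad_poly 1 b c.
Proof. by rewrite /quad_poly scale1r. Qed.

Lemma irrationalP P x : is_minpoly P x -> size P = 3 -> irrational x.
Proof.
move=> [_ _ _ min] P3 e f ef; apply/eqP; apply: contraT => e0.
have h : (size P <= size (quad_poly 0 e f))%N.
  apply: min.
    apply/eqP => /polyP/(_ 1%N); have [_ -> _] := quad_polyE 0 e f.
    by move/eqP; rewrite coef0 (negPf e0).
  by apply/quad_poly_root; rewrite mul0r add0r.
rewrite P3 in h; have : (3 <= 2)%N; last by [].
apply: (leq_trans h); apply/leq_sizeP => j.
rewrite leq_eqVlt => /orP[/eqP <-|]; last exact: quad_poly_coef_ge3.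
by have [] := quad_polyE 0 e f.
Qed.

Lemma irrational_minpoly a b c x : irrational x ->
  a%:~R * x ^+ 2 + b%:~R * x + c%:~R = 0 -> 0 < a ->
  (forall d : int, (d %| a)%Z -> (d %| b)%Z -> (d %| c)%Z -> `|d| = 1) ->
  is_minpoly (quad_poly a b c) x.
Proof.
move=> irr xP a0 prim; have [ea eb ec] := quad_polyE a b c.
have s3 : size (quad_poly a b c) = 3.
  apply/eqP; rewrite eqn_leq size_quad_poly ltnNge; apply/negP => /leq_sizeP.
  by move/(_ 2%N isT); rewrite ea; lia.
split.
- exact/quad_poly_root.
- by rewrite lead_coefE s3 ea.
- by move=> d dP; apply: prim; [rewrite -ea | rewrite -eb | rewrite -ec]; apply: dP.
move=> Q Q0 Qx; rewrite s3 ltnNge; apply/negP => Q2.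
have Q1 : Q`_2 = 0 by move/leq_sizeP: Q2; apply.
move: Qx; rewrite int_root_size3 ?(leq_trans Q2) // Q1 mul0r add0r => Qx.
have e0 := irr _ _ Qx; move: Qx; rewrite e0 mul0r add0r => /eqP.
rewrite padicq_intr_eq0 => /eqP f0; move/eqP: Q0; apply; apply/polyP => i.
rewrite coef0; case: i => [|[|i]] //.
by move/leq_sizeP: Q2; apply.
Qed.

(** Cancelling the leading terms leaves a polynomial of smaller size with root [x], hence 0;
    proportional polynomials have the same primitive part. *)
Lemma is_minpoly_uniq P Q x : is_minpoly P x -> is_minpoly Q x -> P = Q.
Proof.
move=> [Px lcP primP minP] [Qx lcQ primQ minQ].
have P0 : P != 0 by rewrite -lead_coef_eq0 gt_eqF.
have Q0 : Q != 0 by rewrite -lead_coef_eq0 gt_eqF.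
have sPQ : size P = size Q by apply/eqP; rewrite eqn_leq minP // minQ.
pose D := lead_coef P *: Q - lead_coef Q *: P.
have Dx : int_root D x.
  rewrite /int_root /D.
  apply: (@root_intr_comb Qp).
    exact: Px.
  exact: Qx.
have D0 : D = 0.
  apply/eqP; apply: contraT => /minP/(_ Dx); rewrite leqNgt => /negP[].
  rewrite (polySpred P0) ltnS; apply/leq_sizeP => j.
  rewrite leq_eqVlt => /orP[/eqP <-|Pj].
    by rewrite coefB !coefZ /lead_coef -sPQ mulrC subrr.
  have szj : (size P <= j)%N by rewrite (polySpred P0).
  by rewrite coefB !coefZ !nth_default -?sPQ // !mulr0 subr0.
rewrite -(zprimitive_of_coprime lcP primP) -(zprimitive_of_coprime lcQ primQ).
rewrite -(@zprimitiveZ (lead_coef Q) P) ?gt_eqF //.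
rewrite -(@zprimitiveZ (lead_coef P) Q) ?gt_eqF //.
by congr zprimitive; apply/esym/subr0_eq.
Qed.

Lemma minpolyE P x : is_minpoly P x -> minpoly x = P.
Proof. by move=> Px; apply: xget_unique => // Q /is_minpoly_uniq; apply. Qed.

Lemma hensel_irreducibleP b c :
  irreducible_poly (map_poly (intr : int -> rat) (hensel_poly b c)) <->
  (forall r : rat, r ^+ 2 + b%:~R * r + c%:~R != 0).
Proof.
have E : map_poly (intr : int -> rat) (hensel_poly b c) =
   'X^2 + b%:~R *: 'X + c%:~R%:P.
  by rewrite /hensel_poly !rmorphD /= map_polyXn map_polyZ /= map_polyX map_polyC.
have s3 : size (map_poly (intr : int -> rat) (hensel_poly b c)) = 3.
  rewrite E -addrA size_polyDl size_polyXn //.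
  by rewrite (leq_ltn_trans (size_polyD _ _)) // gtn_max
    (leq_ltn_trans (size_scale_leq _ _)) ?size_polyX //
    (leq_ltn_trans (size_polyC_leq1 _)).
split=> [[_ irr] r|H].
  apply/negP => /eqP r0.
  have := irr ('X - r%:P); rewrite size_XsubC dvdp_XsubCl => /(_ isT).
  rewrite E rootE !hornerE r0 eqxx => /(_ isT) /eqp_size.
  by rewrite size_XsubC -E s3.
apply: cubic_irreducible; first by rewrite s3.
by move=> r; rewrite E rootE !hornerE.
Qed.

(** A relation [e x + f = 0] with [e] nonzero would make [- f / e] a rational root. The identity
    passes from Q_p to Q through Z, which embeds in both. *)
Lemma hensel_irrational b c x :
  (forall r : rat, r ^+ 2 + b%:~R * r + c%:~R != 0) ->
  x ^+ 2 + b%:~R * x + c%:~R = 0 -> irrational x.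
Proof.
move=> irr xP e f ef; apply/eqP; apply: contraT => e0.
have : (f * f - b * e * f + c * e * e)%:~R = 0 :> Qp.
  have fE : f%:~R = - (e%:~R * x) by apply/eqP; rewrite -addr_eq0 addrC ef.
  rewrite !(rmorphB, rmorphD, rmorphM) /= fE.
  transitivity (e%:~R ^+ 2 * (x ^+ 2 + b%:~R * x + c%:~R)); last by rewrite xP mulr0.
  by move: e%:~R b%:~R c%:~R => *; ring.
move/eqP; rewrite padicq_intr_eq0 => /eqP E.
have /eqP[] := irr (- f%:~R / e%:~R).
have e1 : (e%:~R : rat) != 0 by rewrite intr_eq0.
apply: (mulIf (expf_neq0 2 e1)); rewrite mul0r.
transitivity ((f * f - b * e * f + c * e * e)%:~R : rat); last by rewrite E.
rewrite !(rmorphB, rmorphD, rmorphM) /=.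
by move: e%:~R e1 b%:~R c%:~R f%:~R => *; field.
Qed.

Lemma irrational_hensel b c x : irrational x ->
  x ^+ 2 + b%:~R * x + c%:~R = 0 ->
  irreducible_poly (map_poly (intr : int -> rat) (hensel_poly b c)).
Proof.
move=> irr xP; apply/hensel_irreducibleP => r; apply/eqP => rP.
have m0 : denq r != 0 by rewrite denq_eq0.
set m := denq r in m0; set n := numq r.
have E : n * n + b * n * m + c * m * m = 0.
  apply: (@intr_inj rat); rewrite !(rmorphD, rmorphM) /=.
  have <- : (m%:~R : rat) ^+ 2 * (r ^+ 2 + b%:~R * r + c%:~R) = 0%:~R.
    by rewrite rP mulr0.
  have -> : (n%:~R : rat) = r * m%:~R.
    by rewrite -[r in RHS]divq_num_den divfK // intr_eq0.
  by move: m%:~R b%:~R c%:~R => *; ring.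
(* The rational root [n / m] and its conjugate [- b - n / m] split the polynomial, so one of two
   linear factors vanishes at [x]. *)
have : (m%:~R * x + (- n)%:~R) * (m%:~R * x + (m * b + n)%:~R) = 0 :> Qp.
  have := congr1 (intr : int -> Qp) E.
  rewrite !(rmorphD, rmorphM, rmorphN) /=.
  move: m%:~R n%:~R b%:~R c%:~R xP => m' n' b' c' xP E'.
  transitivity (m' ^+ 2 * (x ^+ 2 + b' * x + c') -
    (n' * n' + b' * n' * m' + c' * m' * m')).
    by ring.
  by rewrite xP E' mulr0 subr0.
by move/eqP; rewrite mulf_eq0 => /orP[] /eqP /irr /eqP; rewrite (negPf m0).
Qed.

End Minpoly.

(** * The maps T_1 and T_2 *)

Section Step.
Context (p : nat) (p_pr : prime p).
Local Notation Zp := (padic_int p_pr).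
Local Notation Qp := (padic p_pr).
Implicit Types (x y : Qp) (P Q : {poly int}) (a b c : int).

Lemma ucoefE x : ccoef x != 0 ->
  ccoef x = ucoef x * (p ^ logn p `|ccoef x|)%N /\ ~~ (p %| ucoef x)%Z.
Proof.
move=> c0; have p1 := prime_gt1 p_pr.
have cE : ccoef x = ucoef x * (p ^ logn p `|ccoef x|)%N.
  by rewrite /ucoef divzK // dvdzE /= pfactor_dvdnn.
split => //; apply/negP => /dvdzP[q uE].
have : (p ^ (logn p `|ccoef x|).+1 %| `|ccoef x|)%N.
  apply/dvdnP; exists (absz q); rewrite {1}cE uE !abszM /=.
  by rewrite expnS mulnA.
by rewrite pfactor_dvdn ?absz_gt0 // ltnn.
Qed.

Lemma pX_vp_intr (u : int) (l : nat) : ~~ (p %| u)%Z ->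
  u%:~R * p%:R ^ vp ((u * (p ^ l)%N)%:~R : Qp) = (u * (p ^ l)%N)%:~R :> Qp.
Proof.
move=> pu; have -> : (u * (p ^ l)%N)%:~R = p%:R ^ l%:Z * u%:~R :> Qp.
  by rewrite rmorphM /= -pmulrn natrX mulrC.
by rewrite vpE 1?mulrC //; apply: padicq_unit_intr.
Qed.

Lemma ucoef_pvp x : ccoef x != 0 -> vp x = vp ((ccoef x)%:~R : Qp) ->
  (ucoef x)%:~R * p%:R ^ vp x = (ccoef x)%:~R :> Qp.
Proof.
move=> c0 ->; have [] := ucoefE c0.
move: (ucoef x) (ccoef x) (logn _ _) => u c l -> pu.
exact: pX_vp_intr.
Qed.

Lemma digit_forE y (d : nat) : (0 < d < p)%N -> pZp 1 (y - d%:R) ->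
  digit_for y = d.
Proof.
move=> dp yd; apply: xget_unique; first by [].
move=> d' [d'p yd'].
have : pZp 1 ((d'%:Z - d%:Z)%:~R : Qp).
  rewrite rmorphB /= -!pmulrn (_ : _ - _ = (y - d%:R) - (y - d'%:R)).
    exact: pZpB.
  by rewrite opprB [RHS]addrC subrKA.
move/pZp1_intrP/dvdzP => [q E]; move: dp d'p => /andP[d0 dp] /andP[d'0 d'p].
have q0 : q = 0 by nia.
by move: E; rewrite q0; lia.
Qed.

Lemma digit_forE_int y (k : int) : ~~ (p %| k)%Z -> pZp 1 (y - k%:~R) ->
  (digit_for y)%:Z = (k %% p)%Z.
Proof.
move=> pk yk; have p0 : (p : int) != 0 by have := prime_gt0 p_pr; lia.
have k0 : (k %% p)%Z != 0 by apply: contra pk => /eqP/dvdz_mod0P.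
have kge := modz_ge0 k p0.
have klt : (k %% p)%Z < p by apply: ltz_pmod; rewrite ltz_nat prime_gt0.
rewrite (@digit_forE y `|(k %% p)%Z|%N); first by rewrite gez0_abs.
  by lia.
rewrite pmulrn gez0_abs // (_ : y - _ = (y - k%:~R) + ((k %/ p)%Z * p)%:~R).
  apply: pZpD => //; apply/pZp1_intrP; exact: dvdz_mull.
rewrite -addrA; congr (y + _); rewrite -!rmorphN -rmorphD; congr (_%:~R).
by move: (k %/ p)%Z (k %% p)%Z (divz_eq k p) => q r ->; ring.
Qed.

Section Quotients.
Variables (x : Qp) (a b c : int).
Hypotheses (x1 : pZp 1 x) (x0 : x != 0)
  (xP : a%:~R * x ^+ 2 + b%:~R * x + c%:~R = 0)
  (cE : ccoef x = c) (pb : ~~ (p %| b)%Z).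

Let ax_b_unit : padicq_unit (a%:~R * x + b%:~R).
Proof.
rewrite addrC; apply: padicq_unitD; first exact: padicq_unit_intr.
by apply: pZpMl => //; apply: pZp_intr.
Qed.

Let c_eq : c%:~R = - (x * (a%:~R * x + b%:~R)).
Proof.
apply/eqP; rewrite -addr_eq0 -xP; apply/eqP.
by move: a%:~R b%:~R c%:~R => *; ring.
Qed.

Let c_neq0 : c != 0.
Proof.
rewrite -(padicq_intr_eq0 p_pr) c_eq oppr_eq0 mulf_neq0 ?x0 //.
exact: padicq_unit_neq0 ax_b_unit.
Qed.

Let u_eq : (ucoef x)%:~R * p%:R ^ vp x = c%:~R :> Qp.
Proof.
rewrite -cE; apply: ucoef_pvp; rewrite cE //.
have [k [w [wu xE]]] := padicq_decomp x0.
rewrite c_eq -mulrN {1 2}xE -mulrA !vpE //.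
by apply: padicq_unitM => //; apply: padicq_unitN.
Qed.

(** As p does not divide [b], the factor [a x + b] is a unit. By [c = - x (a x + b)], the valuations
    of [x] and [c] agree, so the numerator [u(x) p^v(x)] is [c] itself. The value [a = 0] covers
    rational [x]. *)
Lemma quot1E : quot1 x = - (a%:~R * x + b%:~R).
Proof. by rewrite /quot1 u_eq c_eq mulNr mulrAC mulfV // mul1r. Qed.

Lemma quot2E : quot2 x = a%:~R * x + b%:~R.
Proof. by rewrite /quot2 mulNr u_eq c_eq opprK mulrAC mulfV // mul1r. Qed.

Let quot2_b : pZp 1 (quot2 x - b%:~R).
Proof. by rewrite quot2E addrK; apply: pZpMl => //; apply: pZp_intr. Qed.

Let quot1_b : pZp 1 (quot1 x - (- b)%:~R).
Proof.
rewrite quot1E rmorphN /= opprK opprD subrK; apply: pZpN.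
by apply: pZpMl => //; apply: pZp_intr.
Qed.

Lemma d2E : (d2 x)%:Z = (b %% p)%Z.
Proof. exact: digit_forE_int. Qed.

Lemma d1E : (d1 x)%:Z = ((- b) %% p)%Z.
Proof. by apply: digit_forE_int => //; rewrite dvdzE abszN. Qed.

Lemma T2E : T2 x = a%:~R * x + (b - (b %% p)%Z)%:~R.
Proof.
rewrite /T2 quot2E pmulrn d2E; move: (b %% p)%Z => m.
by rewrite rmorphB /= addrA.
Qed.

Lemma T1E : T1 x = - (a%:~R * x) - (b + ((- b) %% p)%Z)%:~R.
Proof.
rewrite /T1 quot1E pmulrn d1E; move: (- b %% p)%Z => m.
by rewrite rmorphD /=; move: (a%:~R * x) b%:~R m%:~R => *; ring.
Qed.

End Quotients.

Definition hensel_root (bc : int * int) x := [/\ setS p bc, pZp 1 x &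
  x ^+ 2 + bc.1%:~R * x + bc.2%:~R = 0].

Lemma hensel_root_irrational bc x : hensel_root bc x -> irrational x.
Proof.
by move=> [[_ _ /hensel_irreducibleP irr] _ xP]; apply: hensel_irrational xP.
Qed.

Lemma hensel_root_minpoly bc x :
  hensel_root bc x -> minpoly x = hensel_poly bc.1 bc.2.
Proof.
move=> xh; have irr := hensel_root_irrational xh; case: xh => _ _ xP.
apply: minpolyE; rewrite hensel_polyE; apply: irrational_minpoly => //.
  by rewrite mul1r.
by move=> d; rewrite dvdz1 => /eqP d1 _ _; rewrite -abszE d1.
Qed.

Lemma hensel_root_degree bc x : hensel_root bc x -> degree_le2 x.
Proof.
move=> xh; exists (quad_poly 1 bc.1 bc.2); last exact: size_quad_poly.
have irr := hensel_root_irrational xh; case: xh => _ _ xP.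
apply: irrational_minpoly => //; first by rewrite mul1r.
by move=> d; rewrite dvdz1 => /eqP d1 _ _; rewrite -abszE d1.
Qed.

Lemma hensel_root_bcoef bc x : hensel_root bc x -> bcoef x = bc.1.
Proof.
by move=> /hensel_root_minpoly; rewrite /bcoef hensel_polyE => ->;
  have [] := quad_polyE 1 bc.1 bc.2.
Qed.

Lemma hensel_root_ccoef bc x : hensel_root bc x -> ccoef x = bc.2.
Proof.
by move=> /hensel_root_minpoly; rewrite /ccoef hensel_polyE => ->;
  have [] := quad_polyE 1 bc.1 bc.2.
Qed.

Lemma hensel_root_inj bc bc' x : hensel_root bc x -> hensel_root bc' x -> bc = bc'.
Proof.
move=> h h'; rewrite [bc]surjective_pairing [bc']surjective_pairing.
rewrite -(hensel_root_bcoef h) -(hensel_root_ccoef h).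
by rewrite (hensel_root_bcoef h') (hensel_root_ccoef h').
Qed.

Lemma irrational_neq0 x : irrational x -> x != 0.
Proof.
move=> irr; apply/eqP => x0; have := irr 1 0.
by rewrite x0 mulr0 addr0 => /(_ erefl).
Qed.

(** Subtracting the two equations gives [(x - y) (b + x + y) = 0], where the second factor is a unit
    because p does not divide [b]. *)
Lemma hensel_root_uniq bc x y : hensel_root bc x -> hensel_root bc y -> x = y.
Proof.
move=> [[pb _ _] x1 xP] [_ y1 yP].
have : (x - y) * (bc.1%:~R + (x + y)) = 0.
  transitivity ((x ^+ 2 + bc.1%:~R * x + bc.2%:~R) -
    (y ^+ 2 + bc.1%:~R * y + bc.2%:~R)).
    by move: bc.1%:~R bc.2%:~R => *; ring.
  by rewrite xP yP subrr.
move/eqP; rewrite mulf_eq0 subr_eq0 => /orP[/eqP //|].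
have u := padicq_unitD (padicq_unit_intr p_pr pb) (pZpD x1 y1).
by rewrite (negPf (padicq_unit_neq0 u)).
Qed.

Definition uses_T2_int alg (bc : int * int) : bool :=
  match alg with
  | AlgA => true
  | AlgB => 0 <= bc.1
  | AlgC => (0 <= bc.1) && (0 < bc.2)
  end.

Definition T2_int (bc : int * int) : int * int :=
  let d := (bc.1 %% p)%Z in (2 * d - bc.1, bc.2 - d * (bc.1 - d)).

Definition T1_int (bc : int * int) : int * int :=
  let d := (- bc.1 %% p)%Z in (bc.1 + 2 * d, bc.2 + d * (bc.1 + d)).

Definition cfT_int alg bc := if uses_T2_int alg bc then T2_int bc else T1_int bc.

Lemma irrational_affine x y (s : int) (n : int) : irrational x -> s != 0 ->
  y = s%:~R * x + n%:~R -> irrational y.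
Proof.
move=> irr s0 -> e f ef; have /irr /eqP : (e * s)%:~R * x + (e * n + f)%:~R = 0.
  by rewrite -ef !(rmorphD, rmorphM) /= mulrDr !mulrA addrA.
by rewrite mulf_eq0 (negPf s0) orbF => /eqP.
Qed.

(** That p divides [c] follows from [c = - x (x + b)], and irreducibility from the irrationality of
    [x]. *)
Lemma monic_setS b c x : irrational x -> pZp 1 x -> ~~ (p %| b)%Z ->
  x ^+ 2 + b%:~R * x + c%:~R = 0 -> hensel_root (b, c) x.
Proof.
move=> irr x1 pb xP; split=> //; split=> //=; last exact: irrational_hensel xP.
apply/(pZp1_intrP p_pr).
rewrite (_ : c%:~R = - (x * (x + b%:~R))); last first.
  by apply/eqP; rewrite -addr_eq0 -xP; apply/eqP; ring.
apply: pZpN; rewrite mulrC; apply: pZpMl => //.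
by apply: pZpD; [apply: pZpW x1 | exact: pZp_intr].
Qed.

(** Multiplying the equation by [a] makes [a x] a root of the monic polynomial X^2 + b X + a c; the
    translation by [b - d] then yields [T2_int]. Thus one step leads to a Hensel root whatever the
    leading coefficient. *)
Lemma T2_monic a b c x : irrational x -> pZp 1 x -> ~~ (p %| b)%Z -> a != 0 ->
  a%:~R * x ^+ 2 + b%:~R * x + c%:~R = 0 ->
  hensel_root (T2_int (b, a * c)) (a%:~R * x + (b - (b %% p)%Z)%:~R).
Proof.
move=> irr x1 pb a0 xP; rewrite /T2_int /=.
have pm : (p %| b - (b %% p)%Z)%Z.
  by rewrite -eqz_mod_dvd modz_mod.
apply: monic_setS.
- exact: irrational_affine irr a0 _.
- apply: pZpD; last exact/pZp1_intrP.
  by apply: pZpMl => //; apply: pZp_intr.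
- apply: contra pb => h.
  have -> : b = (2 * (b %% p)%Z - b) + (b - (b %% p)%Z) * 2 by ring.
  by rewrite rpredD // dvdz_mulr.
move: (b %% p)%Z => d; rewrite !(rmorphB, rmorphM, rmorphD) /=.
transitivity (a%:~R * (a%:~R * x ^+ 2 + b%:~R * x + c%:~R)); last first.
  by rewrite xP mulr0.
by move: a%:~R b%:~R c%:~R d%:~R => *; ring.
Qed.

(** This is [T2_monic] for the opposite polynomial, with coefficients [- a], [- b], [- c]. *)
Lemma T1_monic a b c x : irrational x -> pZp 1 x -> ~~ (p %| b)%Z -> a != 0 ->
  a%:~R * x ^+ 2 + b%:~R * x + c%:~R = 0 ->
  hensel_root (T1_int (b, a * c)) (- (a%:~R * x) - (b + ((- b) %% p)%Z)%:~R).
Proof.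
move=> irr x1 pb a0 xP.
have xP' : (- a)%:~R * x ^+ 2 + (- b)%:~R * x + (- c)%:~R = 0.
  by rewrite !rmorphN /= !mulNr -!opprD xP oppr0.
have pb' : ~~ (p %| - b)%Z by rewrite dvdzE abszN.
have a0' : - a != 0 by rewrite oppr_eq0.
have h := T2_monic irr x1 pb' a0' xP'.
have <- : (- a)%:~R * x + (- b - (- b %% p)%Z)%:~R =
    - (a%:~R * x) - (b + (- b %% p)%Z)%:~R.
  move: (- b %% p)%Z => m; rewrite -opprD !rmorphN /=.
  by rewrite mulNr.
have -> // : T1_int (b, a * c) = T2_int (- b, - a * - c).
rewrite /T1_int /T2_int /=; move: (- b %% p)%Z => m.
by congr (_, _); ring.
Qed.

End Step.

(** * Purely periodic expansions *)

Section Orbits.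
Context (p : nat) (p_pr : prime p).
Local Notation Zp := (padic_int p_pr).
Local Notation Qp := (padic p_pr).
Implicit Types (x y : Qp) (P Q : {poly int}) (a b c : int) (alg : algorithm).

Lemma uses_T2E alg bc x : bcoef x = bc.1 -> ccoef x = bc.2 ->
  uses_T2 alg x = uses_T2_int alg bc.
Proof. by move=> bE cE; rewrite /uses_T2 bE cE. Qed.

Lemma cfT_monic alg a b c x : irrational x -> pZp 1 x -> ~~ (p %| b)%Z ->
  a != 0 -> a%:~R * x ^+ 2 + b%:~R * x + c%:~R = 0 ->
  ccoef x = c -> exists bc, hensel_root bc (cfT alg x).
Proof.
move=> irr x1 pb a0 xP cE; have x0 := irrational_neq0 irr.
rewrite /cfT; case: uses_T2.
  by rewrite (T2E x1 x0 xP cE pb); exists (T2_int p (b, a * c)); exact: T2_monic.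
by rewrite (T1E x1 x0 xP cE pb); exists (T1_int p (b, a * c)); exact: T1_monic.
Qed.

Lemma hensel_root_cfT alg bc x :
  hensel_root bc x -> hensel_root (cfT_int p alg bc) (cfT alg x).
Proof.
move=> xh; have irr := hensel_root_irrational xh; have x0 := irrational_neq0 irr.
have bE := hensel_root_bcoef xh; have cE := hensel_root_ccoef xh.
case: bc xh bE cE => b c [[/= pb _ _] x1 xP] bE cE.
have xP1 : 1%:~R * x ^+ 2 + b%:~R * x + c%:~R = 0 by rewrite mul1r.
rewrite /cfT /cfT_int (@uses_T2E alg (b, c) x) //; case: uses_T2_int.
  rewrite (T2E x1 x0 xP1 cE pb) -[c]mul1r.
  exact: T2_monic.
rewrite (T1E x1 x0 xP1 cE pb) -[c]mul1r.
exact: T1_monic.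
Qed.

Lemma hensel_root_iter alg bc x i : hensel_root bc x ->
  hensel_root (iter i (cfT_int p alg) bc) (iter i (cfT alg) x).
Proof. by move=> xh; elim: i => //= i; apply: hensel_root_cfT. Qed.

Lemma int_part_pZp1 x : pZp 1 x -> int_part x = 0.
Proof.
move=> x1; rewrite (@int_partE _ _ x 0) // ?ltz_nat ?prime_gt0 //.
by rewrite subr0.
Qed.

Lemma frac_part_pZp1 x : int_part x = 0 -> frac_part x = x.
Proof. by rewrite /frac_part => ->; rewrite /ratr /= mul0r subr0. Qed.

Lemma reduced_of_periodic alg bc l x : hensel_root bc x -> (0 < l)%N ->
  iter l (cfT_int p alg) bc = bc -> reduced_set p_pr alg x.
Proof.
move=> xh l0 bcl; split; first exact: hensel_root_degree xh.
have x1 : pZp 1 x by case: xh.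
have xE := frac_part_pZp1 (int_part_pZp1 x1).
have xl : iter l (cfT alg) x = x.
  by have := hensel_root_iter alg l xh; rewrite bcl => /hensel_root_uniq; apply.
split; last exists l => // i.
- move=> i; rewrite /cf_iter xE.
  exact: irrational_neq0 (hensel_root_irrational (hensel_root_iter alg i xh)).
- exact: int_part_pZp1.
by rewrite /cf_term /cf_iter xE iterD xl.
Qed.

(** No integer from 1 to p - 1 lies in p Z_p, so [xget] falls back on its default. *)
Lemma digit_for0 : digit_for (0 : Qp) = 0%N.
Proof.
apply: xgetPN => d [/andP[d0 dp]]; rewrite sub0r pmulrn -rmorphN.
move/pZp1_intrP; rewrite dvdzE abszN /= => /(dvdn_leq d0).
by rewrite leqNgt dp.
Qed.

Lemma digit_for_unit y : padicq_unit y ->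
  (0 < digit_for y < p)%N /\ pZp 1 (y - (digit_for y)%:R).
Proof.
move=> yu; have [z [yE _]] := padicq_unitP yu.
have z1 : pZp 1 (y - (absz (pres z 1))%:R).
  rewrite pmulrn gez0_abs; last by have /andP[] := pres_bound z 1.
  rewrite yE -[_%:~R](rmorph_int (@FracField.tofrac Zp)) -rmorphB.
  apply/(pZp_tofracP 1); rewrite presD presN pres_intr -[RHS](mod0z (p ^ 1)%N).
  by rewrite modzDmr -modzDmr modzNm modzDmr subrr.
have d0 : (0 < absz (pres z 1) < p)%N.
  have /andP[z0 zp] := pres_bound z 1; rewrite expn1 in zp.
  apply/andP; split; last by lia.
  rewrite absz_gt0; apply/eqP => z10; case: yu => _; apply.
  by rewrite -[y]subr0; move: z1; rewrite z10.
by rewrite (digit_forE d0 z1).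
Qed.

Lemma cfT_def alg x : cfT alg x = (cft alg x)%:~R * p%:R ^ vp x / x - (cfd alg x)%:R
  /\ cfd alg x = digit_for ((cft alg x)%:~R * p%:R ^ vp x / x).
Proof.
rewrite /cfT /cft /cfd; case: uses_T2.
  by rewrite /T2 /d2 /quot2 rmorphN.
by rewrite /T1 /d1 /quot1.
Qed.

Lemma cfT_step alg x : pZp 1 x -> x != 0 -> cfT alg x != 0 ->
  [/\ pZp 1 (cfT alg x), 1 <= vp x, (0 < cfd alg x < p)%N &
    x * (cfT alg x + (cfd alg x)%:R) = (cft alg x)%:~R * p%:R ^ vp x].
Proof.
move=> x1 x0 Tx0; have [TE dE] := cfT_def alg x.
have xT : x * (cfT alg x + (cfd alg x)%:R) = (cft alg x)%:~R * p%:R ^ vp x.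
  by rewrite TE subrK mulrC divfK.
have [k [w [wu xE]]] := padicq_decomp x0.
have vE : vp x = k by rewrite xE vpE.
(* Junk values: without a minimal polynomial c = 0, hence t = 0, d = 0, T x = 0. *)
have c0 : ccoef x != 0.
  apply/eqP => c0; have t0 : cft alg x = 0.
    by rewrite /cft /ucoef c0 div0z oppr0; case: uses_T2.
  by move: Tx0; rewrite TE dE t0 !mul0r digit_for0 subr0 eqxx.
have [_ pu] := ucoefE c0.
have pt : ~~ (p %| cft alg x)%Z.
  by rewrite /cft; case: uses_T2 => //; rewrite dvdzE abszN.
(* The quotient is [t] over the unit part [w] of [x], and p does not divide [t]; being a unit, it
   has a digit. *)
have yu : padicq_unit ((cft alg x)%:~R * p%:R ^ vp x / x).
  rewrite (_ : _ / _ = (cft alg x)%:~R / w).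
    by apply: padicq_unitM; [apply: padicq_unit_intr | apply: padicq_unitV].
  rewrite vE xE; move: (padicq_pX_neq0 p_pr k); move: (p%:R ^ k) => q q0.
  by rewrite invfM [q^-1 * _]mulrC mulrA mulrAC mulfK.
have [dp yd] := digit_for_unit yu; rewrite -dE in dp yd.
split=> //; first by rewrite TE.
by rewrite vE; apply: (pZp_pX_unit wu); rewrite -xE.
Qed.

(** By the identity [(X_i - Y_i) (X_(i+1) + d_i) = - Y_i (X_(i+1) - Y_(i+1))], with [X_(i+1) + d_i]
    a unit and [Y_i] in p Z_p, agreement modulo p^n at all indices improves to agreement modulo
    p^(n+1). *)
Lemma pZp_contraction (X Y : nat -> Qp) (s : nat -> Qp) (d : nat -> nat) :
  (forall i, [/\ pZp 1 (X i), pZp 1 (Y i) & (0 < d i < p)%N]) ->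
  (forall i, X i * (X i.+1 + (d i)%:R) = s i) ->
  (forall i, Y i * (Y i.+1 + (d i)%:R) = s i) -> X =1 Y.
Proof.
move=> XYd Xs Ys i; apply/subr0_eq/pZp_small => n.
elim: n i => [|n IHn] i.
  by apply: (@pZpW _ _ _ 1) => //; have [X1 Y1 _] := XYd i; apply: pZpB.
have [_ Yi1 /andP[d0 dp]] := XYd i; have [Xi1 _ _] := XYd i.+1.
have du : padicq_unit (X i.+1 + (d i)%:R).
  rewrite addrC; apply: padicq_unitD => //.
  rewrite pmulrn; apply: padicq_unit_intr.
  by rewrite dvdzE /=; apply/negP => /(dvdn_leq d0); rewrite leqNgt dp.
apply: (pZp_mulr_unit du).
have -> : (X i - Y i) * (X i.+1 + (d i)%:R) = - (Y i * (X i.+1 - Y i.+1)).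
  rewrite mulrBl Xs -Ys; move: (X i.+1) (Y i) (Y i.+1) (d i)%:R => *; ring.
apply: pZpN; rewrite (_ : n.+1%:Z = 1 + n%:Z); last by lia.
exact: pZpM.
Qed.

(* Modulo p the matrices [[0, s_i], [1, d_i]] are lower triangular with zero first
   row, so that A and B vanish and E is the product of the d_i. *)
Lemma moebius_relation (X : nat -> Qp) (s : nat -> int) (d : nat -> nat) :
  (forall i, (p %| s i)%Z) -> (forall i, ~~ (p %| d i)%N) ->
  (forall i, X i * (X i.+1 + (d i)%:R) = (s i)%:~R) ->
  forall l, exists A B C E : int,
    [/\ (p %| A)%Z, (p %| B)%Z, ~~ (p %| E)%Z &
      X 0%N * (C%:~R * X l.+1 + E%:~R) = A%:~R * X l.+1 + B%:~R].
Proof.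
move=> ps pd Xs; elim=> [|l [A [B [C [E [pA pB pE IHl]]]]]].
  exists 0, (s 0%N), 1, (d 0%N); rewrite mul1r mul0r add0r -pmulrn Xs.
  by split; rewrite ?dvdz0 ?ps // dvdzE pd.
exists B, (A * s l.+1 + B * d l.+1), E, (C * s l.+1 + E * d l.+1); split=> //.
- by rewrite rpredD // dvdz_mulr.
- have h : ~~ (p %| E * d l.+1)%Z.
    by rewrite dvdzE abszM /= Euclid_dvdM // negb_or pd andbT; exact: pE.
  apply: contra h => h.
  rewrite (_ : E * d l.+1 = (C * s l.+1 + E * d l.+1) - C * s l.+1); last by ring.
  by rewrite rpredB // dvdz_mull.
rewrite !(rmorphD, rmorphM) /= -!pmulrn -Xs.
have := congr1 (fun u => u * (X l.+2 + (d l.+1)%:R)) IHl => /= {}IHl.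
transitivity (X 0%N * (C%:~R * X l.+1 + E%:~R) * (X l.+2 + (d l.+1)%:R)).
  move: (X 0%N) (X l.+1) (X l.+2) (d l.+1)%:R C%:~R E%:~R => *; ring.
rewrite IHl.
move: (X l.+1) (X l.+2) (d l.+1)%:R A%:~R B%:~R => *; ring.
Qed.

(** The constant coefficient [c = - (a x + b) x] is divisible by p, so p cannot divide both [a] and
    [b] in a primitive polynomial. *)
Lemma minpoly_ndvd_coef1 P x : is_minpoly P x -> (size P <= 3)%N -> pZp 1 x ->
  (p %| P`_2)%Z -> ~~ (p %| P`_1)%Z.
Proof.
move=> [/int_root_size3 xP _ prim _] P3 x1 pa; apply/negP => pb.
have pc : (p %| P`_0)%Z.
  apply/(pZp1_intrP p_pr).
  have -> : (P`_0)%:~R = - (((P`_2)%:~R * x + (P`_1)%:~R) * x).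
    apply/eqP; rewrite -addr_eq0 -(xP P3); apply/eqP.
    by move: (P`_0)%:~R (P`_1)%:~R (P`_2)%:~R => *; ring.
  apply: pZpN; apply: pZpMl => //; apply: pZpD; last exact: pZp_intr.
  by apply: pZpMl; [exact: pZp_intr | apply: pZpW x1].
have /eqP[] : `|p%:Z| != 1 by have := prime_gt1 p_pr; lia.
apply: prim => -[|[|[|i]]] //.
by rewrite nth_default ?dvdz0 // (leq_trans P3).
Qed.

Lemma intr_minpoly (n : int) : is_minpoly (quad_poly 0 1 (- n)) (n%:~R : Qp).
Proof.
have [_ e1 e0] := quad_polyE 0 1 (- n).
have s2 : size (quad_poly 0 1 (- n)) = 2.
  apply/eqP; rewrite eqn_leq; apply/andP; split.
    apply/leq_sizeP => j; rewrite leq_eqVlt => /orP[/eqP <-|].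
      by have [] := quad_polyE 0 1 (- n).
    exact: quad_poly_coef_ge3.
  by rewrite ltnNge; apply/negP => /leq_sizeP/(_ 1%N isT); rewrite e1.
split.
- by apply/quad_poly_root; rewrite mul0r add0r mul1r rmorphN subrr.
- by rewrite lead_coefE s2 e1.
- by move=> d /(_ 1%N); rewrite e1 dvdz1 -abszE => /eqP ->.
move=> Q Q0 Qx; rewrite s2 ltnNge; apply/negP => Q1.
move: Qx; rewrite int_root_size3 ?(leq_trans Q1) //.
have Qi i : (0 < i)%N -> Q`_i = 0.
  by move=> i0; rewrite nth_default // (leq_trans Q1).
rewrite (Qi 1%N) ?(Qi 2%N) // !mul0r !add0r => /eqP.
rewrite padicq_intr_eq0 => /eqP Q00; move/eqP: Q0; apply.
by rewrite (size1_polyC Q1) Q00.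
Qed.

(** The minimal polynomial is X - n, so [b = 1]; the digits are 1 for T_2 and p - 1 for T_1, which
    give the values 0 and - p. *)
Lemma cfT_intr alg (n : int) : (p %| n)%Z -> n != 0 ->
  cfT alg (n%:~R : Qp) = if uses_T2_int alg (1, - n) then 0 else (- p%:Z)%:~R.
Proof.
move=> pn n0; have x1 : pZp 1 (n%:~R : Qp) by apply/pZp1_intrP.
have x0 : (n%:~R : Qp) != 0 by rewrite padicq_intr_eq0.
have [_ e1 e0] := quad_polyE 0 1 (- n).
have bE : bcoef (n%:~R : Qp) = 1 by rewrite /bcoef (minpolyE (intr_minpoly n)).
have cE : ccoef (n%:~R : Qp) = - n by rewrite /ccoef (minpolyE (intr_minpoly n)).
have xP : (0 : int)%:~R * (n%:~R : Qp) ^+ 2 + (1 : int)%:~R * n%:~R + (- n)%:~R = 0.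
  by rewrite mul0r add0r mul1r rmorphN subrr.
have p1 := prime_gt1 p_pr.
have p_ndvd1 : ~~ (p %| (1 : int))%Z by rewrite dvdz1; lia.
have m1 : (1 %% p)%Z = 1 by rewrite modz_small //; lia.
have mN1 : (- (1 : int) %% p)%Z = p%:Z - 1.
  by rewrite -[LHS](modzMDl 1) mul1r modz_small //; lia.
rewrite /cfT (@uses_T2E alg (1, - n)) //; case: ifP => _.
  by rewrite (T2E x1 x0 xP cE p_ndvd1) mul0r add0r m1 subrr.
rewrite (T1E x1 x0 xP cE p_ndvd1) mul0r oppr0 add0r mN1 -rmorphN.
by rewrite addrC subrK.
Qed.

Lemma intr_terminates alg (n : int) : (p %| n)%Z -> n != 0 ->
  exists i, iter i (cfT alg) (n%:~R : Qp) = 0.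
Proof.
move=> pn n0; have := cfT_intr alg pn n0.
case U : uses_T2_int => nT; first by exists 1%N.
(* After T_1 the value is - p, with minimal polynomial X + p; there [b] and [c] are positive, so
   every algorithm applies T_2 and reaches 0. *)
exists 2%N => /=; rewrite nT cfT_intr ?dvdzE ?abszN //; last first.
  by have := prime_gt0 p_pr; lia.
case: alg U {nT} => //= _.
by rewrite opprK ltz_nat prime_gt0.
Qed.

Lemma periodic_of_reduced alg x : reduced_set p_pr alg x ->
  exists bc l, [/\ hensel_root bc x, (0 < l)%N & iter l (cfT_int p alg) bc = bc].
Proof.
move=> [[P xP P3] [inf int0 [l l0 per]]].
have x1 := int_part_eq0 int0; have fE := frac_part_pZp1 int0.
pose X i := iter i (cfT alg) x.
have XE i : cf_iter alg x i = X i by rewrite /cf_iter fE.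
have X0 i : X i != 0 by rewrite -XE.
have X1 i : pZp 1 (X i).
  by elim: i => // i IHi; have [] := cfT_step IHi (X0 i) (X0 i.+1).
have Xstep i := cfT_step (X1 i) (X0 i) (X0 i.+1).
have perE i : [/\ cft alg (X (i + l)%N) = cft alg (X i),
    vp (X (i + l)%N) = vp (X i) & cfd alg (X (i + l)%N) = cfd alg (X i)].
  have e := per i; split.
  - by have := congr1 (fun u => u.1.1) e; rewrite -!XE; exact.
  - by have := congr1 (fun u => u.1.2) e; rewrite -!XE; exact.
  by have := congr1 (fun u => u.2) e; rewrite -!XE; exact.
(* The orbit and its shift by [l] satisfy the same recurrence, so contraction identifies them. *)
have XlX : X l = x.
  apply/esym; apply: (@pZp_contraction X (fun i => X (i + l)%N)
    (fun i => (cft alg (X i))%:~R * p%:R ^ vp (X i))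
    (fun i => cfd alg (X i)) _ _ _ 0%N).
  - by move=> i; split=> //; have [] := Xstep i.
  - by move=> i; have [] := Xstep i.
  - by move=> i; have [_ _ _] := Xstep (i + l)%N; have [-> -> ->] := perE i.
have xP' : (P`_2)%:~R * x ^+ 2 + (P`_1)%:~R * x + (P`_0)%:~R = 0.
  by case: xP => /int_root_size3 h _ _ _; apply: h.
have bE : bcoef x = P`_1 by rewrite /bcoef (minpolyE xP).
have cE : ccoef x = P`_0 by rewrite /ccoef (minpolyE xP).
(* For rational [x] the leading coefficient [a] is 0, so T x is a nonzero integer divisible by p;
   its orbit reaches 0, against infinitude. *)
have [P2|P2] := leqP (size P) 2.
  have a0 : P`_2 = 0 by rewrite nth_default.
  have pb := minpoly_ndvd_coef1 xP P3 x1; rewrite a0 dvdz0 in pb.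
  have [n nE] : exists n : int, cfT alg x = n%:~R.
    rewrite a0 in xP'; rewrite /cfT; case: uses_T2.
      by rewrite (T2E x1 (X0 0%N) xP' cE (pb isT)) mul0r add0r; eexists.
    by rewrite (T1E x1 (X0 0%N) xP' cE (pb isT)) mul0r oppr0 sub0r -rmorphN; eexists.
  have pn : (p %| n)%Z by apply/(pZp1_intrP p_pr); rewrite -nE; apply: (X1 1%N).
  have n0 : n != 0.
    by rewrite -(padicq_intr_eq0 p_pr) -nE; apply: (X0 1%N).
  have [i] := intr_terminates alg pn n0.
  by rewrite -nE -iterSr => /eqP; rewrite (negPf (X0 i.+1)).
have sP : size P = 3 by apply/eqP; rewrite eqn_leq P3.
have irr := irrationalP xP sP.
have a0 : P`_2 != 0.
  by case: xP => _; rewrite lead_coefE sP /= => h _ _; rewrite gt_eqF.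
have pb : ~~ (p %| P`_1)%Z.
  apply/negP => pb.
  pose s i := cft alg (X i) * (p ^ absz (vp (X i)))%N.
  have sE i : (cft alg (X i))%:~R * p%:R ^ vp (X i) = (s i)%:~R :> Qp.
    have [_ v1 _ _] := Xstep i.
    rewrite /s rmorphM /= -pmulrn natrX exprnP gez0_abs //.
    exact: le_trans v1.
  have ps i : (p %| s i)%Z.
    have [_ v1 _ _] := Xstep i; rewrite dvdz_mull // dvdzE /= dvdn_exp //; lia.
  have pd i : ~~ (p %| cfd alg (X i))%N.
    have [_ _ /andP[d0 dp] _] := Xstep i.
    by apply/negP => /(dvdn_leq d0); rewrite leqNgt dp.
  have Xs i : X i * (X i.+1 + (cfd alg (X i))%:R) = (s i)%:~R.
    by have [_ _ _ ->] := Xstep i.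
  (* The relation for [l.-1] ends at [X l], which is [x] again. *)
  have [A [B [C [E [pA pB pE]]]]] := moebius_relation ps pd Xs l.-1.
  rewrite prednK // XlX /= => rel.
  (* Eliminating x^2 between the relation and the minimal polynomial leaves a linear relation, so
     irrationality gives [a (E - A) = C b]. As p divides [b] but not [E - A], it divides [a], a
     contradiction. *)
  have /irr aEA : (P`_2 * (E - A) - C * P`_1)%:~R * x +
      (- P`_2 * B - C * P`_0)%:~R = 0.
    rewrite !(rmorphB, rmorphM, rmorphN) /=.
    transitivity ((P`_2)%:~R * (x * (C%:~R * x + E%:~R) - (A%:~R * x + B%:~R)) -
      C%:~R * ((P`_2)%:~R * x ^+ 2 + (P`_1)%:~R * x + (P`_0)%:~R)).
      move: (P`_2)%:~R (P`_1)%:~R (P`_0)%:~R A%:~R B%:~R C%:~R E%:~R => *; ring.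
    by rewrite rel xP' subrr !mulr0 subrr.
  have paEA : (p %| P`_2 * (E - A))%Z.
    by rewrite (subr0_eq aEA) dvdz_mull.
  have pEA : ~~ (p %| E - A)%Z.
    by apply: contra pE => h; rewrite -(subrK A E) rpredD.
  have pa : (p %| P`_2)%Z.
    move: paEA; rewrite !dvdzE abszM /= Euclid_dvdM // => /orP[//|].
    by move=> h; case/negP: pEA; exact: h.
  by have := minpoly_ndvd_coef1 xP P3 x1 pa; rewrite pb.
have [bc bcT] := cfT_monic alg irr x1 pb a0 xP' cE.
have h i : hensel_root (iter i (cfT_int p alg) bc) (X i.+1).
  by rewrite /X iterSr; apply: hensel_root_iter.
exists (iter l.-1 (cfT_int p alg) bc), l.
have := h l.-1; rewrite prednK // XlX => hx.
(* Both pairs belong to the same root, since T^l x = x, and a root determines its pair. *)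
split=> //; apply: (@hensel_root_inj _ p_pr _ _ x _ hx).
by have := hensel_root_iter alg l hx; rewrite -/(X l) XlX.
Qed.

End Orbits.

(** * The dynamics on pairs of integers *)

Section Dynamics.
Implicit Types (y z bc : int * int).

(** From a start outside [X], every later iterate is in [X] or has a first coordinate strictly
    smaller in absolute value than the start. The return to the start after [l] steps contradicts
    both. *)
Lemma periodic_absorbed (F : int * int -> int * int) (X : int * int -> Prop) bc l :
  (forall i, let y := iter i F bc in
     (X y -> X (F y)) /\ (~ X y -> X (F y) \/ `|(F y).1| < `|y.1|)) ->
  (0 < l)%N -> iter l F bc = bc -> X bc.
Proof.
move=> H l0 per; apply: contrapT => nX.
suff /(_ l.-1) : forall i, X (iter i.+1 F bc) \/ `|(iter i.+1 F bc).1| < `|bc.1|.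
  by rewrite prednK // per ltxx => -[].
elim=> [|i [IHi|IHi]]; first by have [_ /(_ nX)] := H 0%N.
  by left; have [h _] := H i.+1; apply: h.
have [h1 h2] := H i.+1; have [Xi|nXi] := pselect (X (iter i.+1 F bc)).
  by left; apply: h1.
have [|h] := h2 nXi; first by left.
by right; apply: lt_trans IHi.
Qed.

(** Pigeonhole: the orbit lives in a finite box, hence repeats, and injectivity along the orbit
    moves the repetition back to the start. *)
Lemma periodic_of_bounded (F : int * int -> int * int) bc (N : nat) :
  (forall i, let y := iter i F bc in `|y.1| <= N%:Z /\ `|y.2| <= N%:Z) ->
  (forall i j, F (iter i F bc) = F (iter j F bc) -> iter i F bc = iter j F bc) ->
  exists2 l, (0 < l)%N & iter l F bc = bc.
Proof.
move=> bnd inj.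
pose ints := [seq k%:Z - N%:Z | k <- iota 0 (2 * N).+1].
have intsP (k : int) : `|k| <= N%:Z -> k \in ints.
  move=> kN; apply/mapP; exists (absz (k + N%:Z)).
    by rewrite mem_iota; lia.
  by lia.
pose box := [seq (b, c) | b <- ints, c <- ints].
pose s := [seq iter i F bc | i <- iota 0 (size box).+1].
have /uniqPn : ~~ uniq s.
  apply/negP => us; suff : (size s <= size box)%N by rewrite size_map size_iota ltnn.
  apply: uniq_leq_size us _ => y /mapP[i _ ->].
  rewrite [iter _ _ _]surjective_pairing.
  by have [b1 b2] := bnd i; apply: allpairs_f; apply: intsP.
move=> /(_ bc)[i [j [ij]]]; rewrite size_map size_iota => js.
rewrite !(nth_map 0%N) ?size_iota ?(ltn_trans ij) // !nth_iota ?(ltn_trans ij) //.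
rewrite !add0n => E; exists (j - i)%N; first by rewrite subn_gt0.
(* The common first [i] steps are cancelled one at a time, which keeps [j - i]. *)
elim: i j ij {js} E => [|i IHi] [|j] //.
rewrite ltnS subSS => ij E; apply: IHi => //; exact: inj.
Qed.

Context (p : nat) (p_pr : prime p).

Lemma residues (b : int) : ~~ (p %| b)%Z -> exists k d : int,
  [/\ b = k * p%:Z + d, 0 < d < p%:Z, (b %% p)%Z = d & (- b %% p)%Z = p%:Z - d].
Proof.
move=> pb; have p0 : (0 : int) < p by rewrite ltz_nat prime_gt0.
have d0 : (b %% p)%Z != 0 by apply: contra pb => /eqP/dvdz_mod0P.
have dge : 0 <= (b %% p)%Z by rewrite modz_ge0 // gt_eqF.
have dlt := ltz_pmod b p0.
exists (b %/ p)%Z, (b %% p)%Z; split=> //; first exact: divz_eq.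
  by rewrite lt_neqAle eq_sym d0 dge.
rewrite {1}(divz_eq b p) opprD -mulNr modzMDl.
rewrite -[LHS](modzMDl 1) mul1r modz_small //; lia.
Qed.

Let p0 : (0 : int) < p.
Proof. by rewrite ltz_nat prime_gt0. Qed.

Lemma modz_unique (k d : int) : 0 <= d < p%:Z -> ((k * p%:Z + d) %% p)%Z = d.
Proof. by move=> dp; rewrite modzMDl modz_small. Qed.

(** Since [b = q p + d], the new first coordinate [2 d - b = - q p + d] has the same residue [d]. *)
Lemma T2_intK y : T2_int p (T2_int p y) = y.
Proof.
case: y => b c; rewrite /T2_int /=.
have -> : ((2 * (b %% p)%Z - b) %% p)%Z = (b %% p)%Z.
  rewrite {2}(divz_eq b p); move: (b %/ p)%Z (b %% p)%Z (modz_mod b p) => q r rr.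
  by rewrite (_ : _ - _ = - q * p%:Z + r) ?modzMDl //; ring.
by move: (b %% p)%Z => d; congr (_, _); ring.
Qed.

Lemma T1_intE y : T1_int p y = T2_int p (- y.1, y.2).
Proof.
rewrite /T1_int /T2_int /=; move: (- y.1 %% p)%Z => d.
by congr (_, _); ring.
Qed.

Definition disc y := y.1 ^+ 2 - 4 * y.2.

Lemma disc_T2 y : disc (T2_int p y) = disc y.
Proof.
by rewrite /disc /T2_int /=; move: (y.1 %% p)%Z => d; ring.
Qed.

Lemma disc_cfT alg y : disc (cfT_int p alg y) = disc y.
Proof.
rewrite /cfT_int T1_intE; case: uses_T2_int; first exact: disc_T2.
by rewrite disc_T2 /disc /= sqrrN.
Qed.

Lemma setS_ndvd y : setS p y -> ~~ (p %| y.1)%Z.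
Proof. by case. Qed.

Lemma setS_noroot y (n : int) : setS p y -> n ^+ 2 + y.1 * n + y.2 != 0.
Proof.
move=> [_ _ /hensel_irreducibleP/(_ n%:~R)]; apply: contra => /eqP E.
by rewrite -rmorphXn -rmorphM -!rmorphD /= E.
Qed.

Lemma algB_fixed y : 1 <= y.1 <= p%:Z - 1 -> cfT_int p AlgB y = y.
Proof.
case: y => b c /= bp; rewrite /cfT_int /= /T2_int /=.
rewrite (_ : 0 <= b); last by lia.
by rewrite modz_small; [congr (_, _); ring | lia].
Qed.

Lemma algB_step y : setS p y -> ~ (1 <= y.1 <= p%:Z - 1) ->
  1 <= (cfT_int p AlgB y).1 <= p%:Z - 1 \/ `|(cfT_int p AlgB y).1| < `|y.1|.
Proof.
case: y => b c /setS_ndvd /= /residues[k [d [bE dp m2 m1]]].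
rewrite /cfT_int /= /T2_int /T1_int /= m1 m2; move: p0 bE dp => q0 {m1 m2}.
move: (p : int) q0 => q q0 -> dp nb.
(* Write [b = k p + d]. For [k >= 1], T_2 gives [d - k p], smaller in absolute value than [b]. For
   negative [k], T_1 gives [(k + 2) p - d], which is [p - d] when [k = -1] and is smaller than [b]
   in absolute value when [k <= -2]. *)
have [k1|[k0|[k1|k2]]] : 1 <= k \/ k = 0 \/ k = -1 \/ k <= -2 by lia.
- by rewrite (_ : 0 <= _) /=; [right; nia | nia].
- by case: nb; rewrite k0; lia.
- by rewrite (_ : (0 <= _) = false) /= k1; [left; lia | lia].
by rewrite (_ : (0 <= _) = false) /=; [right; nia | nia].
Qed.

(* The pairs of P_1, R_1, S_3 and S_4, up to membership in S.  The first case
   excludes b < p by itself, as b - (b %% p) is then 0. *)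
Definition algC_reduced y : Prop :=
  [\/ [/\ 0 < y.1, 0 < y.2 & y.2 < (y.1 %% p)%Z * (y.1 - (y.1 %% p)%Z)],
      1 <= y.1 <= p%:Z - 1 /\ 0 < y.2 | y.1 != 0 /\ y.2 < 0].

Lemma algC_absorbing y : setS p y -> setS p (cfT_int p AlgC y) ->
  algC_reduced y -> algC_reduced (cfT_int p AlgC y).
Proof.
case: y => b c /setS_ndvd /= /residues[k [d [bE dp m2 m1]]] Sy.
have c'0 := setS_noroot 0 Sy; have b'0 : (cfT_int p AlgC (b, c)).1 != 0.
  by apply: contra (setS_ndvd Sy) => /eqP ->; rewrite dvdz0.
move: c'0 b'0; rewrite expr0n mulr0 !add0r {Sy}.
rewrite /algC_reduced /cfT_int /= /T2_int /T1_int /= m1 m2.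
case: ifP => [/andP[b0 c0]|bc] /= c'0 b'0; move: (bE) => bE'.
  (* Under T_2 the inequality defining P_1 makes the new [c] negative, while a pair with [k = 0] is
     fixed. *)
  case=> [[bgt cgt cd]|[bp cgt]|[_]]; last by rewrite ltNge ltW.
    by apply: Or33; split=> //; lia.
  apply: Or32; have k0 : k = 0 by nia.
  by move: bE; rewrite k0; nia.
case=> [[bgt cgt _]|[bp cgt]|[bn0 cn]].
- by move: bc; rewrite ltW // cgt.
- by move: bc; rewrite cgt; lia.
(* Let [d' = p - d] be the digit of T_1, and [b' = b + 2 d'], [c' = c + d' (b + d')] the new pair.
   If [c'] is positive then so is [b + d']; moreover [b'] has residue [d'], and [c < 0] says exactly
   [c' < d' (b' - d')], the inequality of P_1. *)
have [c'n|c'p] := ltP (c + (p%:Z - d) * (b + (p%:Z - d))) 0; first by apply: Or33.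
apply: Or31.
have bpd : b + (p%:Z - d) = (k + 1) * p%:Z by rewrite bE; ring.
have pd0 : 0 < p%:Z - d by lia.
have h : 0 < b + (p%:Z - d).
  have : 0 < (p%:Z - d) * (b + (p%:Z - d)) by lia.
  by rewrite pmulr_rgt0.
have -> : ((b + 2 * (p%:Z - d)) %% p)%Z = p%:Z - d.
  rewrite (_ : b + _ = (k + 1) * p%:Z + (p%:Z - d)); last by rewrite bE; ring.
  by rewrite modz_unique //; lia.
split; [by lia | by rewrite lt_neqAle eq_sym c'0 |].
by rewrite (_ : b + _ - _ = b + (p%:Z - d)); [lia | ring].
Qed.

Lemma algC_step y : setS p y -> ~ algC_reduced y ->
  algC_reduced (cfT_int p AlgC y) \/ `|(cfT_int p AlgC y).1| < `|y.1|.
Proof.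
case: y => b c Sy; have /= /residues[k [d [bE dp m2 m1]]] := setS_ndvd Sy.
have := setS_noroot 0 Sy; rewrite expr0n mulr0 !add0r /= => c0 {Sy}.
rewrite /algC_reduced /cfT_int /= m2 => nX.
have b0 : b != 0.
  have [k0|k0] : 0 <= k \/ k <= -1 by lia.
    by move: p0 => q0; nia.
  by move: p0 => q0; nia.
have cgt : 0 < c.
  by rewrite lt_neqAle eq_sym c0 leNgt; apply/negP => cn; apply: nX; apply: Or33.
rewrite cgt andbT; case: ifP => [bge|blt].
  right; rewrite /T2_int /= m2.
  have [k0|[k0|k0]] : k <= -1 \/ k = 0 \/ 1 <= k by lia.
  - by move: p0 => q0; nia.
  - by case: nX; apply: Or32; split=> //; move: bE; rewrite k0; lia.
  by move: p0 => q0; nia.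
(* The first coordinate moves as for Algorithm B. When [k = -1], [b + (p - d)] is 0, so [c] keeps
   its positive value and the pair lands in R_1. *)
rewrite /T1_int /= m1; have [k1|[k1|k1]] : 0 <= k \/ k = -1 \/ k <= -2 by lia.
- by move: p0 => q0; nia.
- left; apply: Or32; move: bE; rewrite k1 => ->; split; first by lia.
  by rewrite (_ : _ * p%:Z + d + (p%:Z - d) = 0) ?mulr0 ?addr0 //; ring.
by right; move: p0 => q0; nia.
Qed.

(** As T_2 is an involution, the image determines [(b, c)] or [(- b, c)] according to the branch; on
    the reduced set the branch is the sign of [c], which is then known. *)
Lemma algC_inj y z : algC_reduced y -> algC_reduced z ->
  cfT_int p AlgC y = cfT_int p AlgC z -> y = z.
Proof.
have neg u : algC_reduced u -> ~~ uses_T2_int AlgC u -> u.2 < 0.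
  rewrite /= negb_and => -[[u1 u2 _]|[/andP[u1 _] u2]|[]//]; rewrite u2 orbF.
    by rewrite ltW.
  by rewrite (le_trans _ u1).
have pos u : uses_T2_int AlgC u -> 0 < u.2 by case/andP.
move=> Xy Xz; rewrite /cfT_int !T1_intE.
case: ifPn => uy; case: ifPn => uz /(congr1 (T2_int p)); rewrite !T2_intK.
- by [].
- move=> yz; have := pos _ uy.
  by rewrite yz /= => /(lt_trans (neg _ Xz uz)); rewrite ltxx.
- move=> yz; have := pos _ uz.
  by rewrite -yz /= => /(lt_trans (neg _ Xy uy)); rewrite ltxx.
by case: y z {Xy Xz uy uz} => [b c] [b' c'] [/oppr_inj -> ->].
Qed.

Lemma algC_bounded (D : int) : exists N : nat, forall y,
  setS p y -> algC_reduced y -> disc y = D -> `|y.1| <= N%:Z /\ `|y.2| <= N%:Z.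
Proof.
(* A common bound for the three cases: [c] is at most [p (|D| + 2 p)] on P_1 and at most [|D| + p^2]
   on R_1, and both coordinates are at most [|D|] in absolute value when [c < 0]. *)
exists (absz (p%:Z * (`|D| + 2 * p%:Z) + `|D| + p%:Z ^+ 2)) => y Sy Xy yD.
rewrite gez0_abs; last by move: p0 => q0; nia.
case: y Sy Xy yD => b c /setS_ndvd /= /residues[k [d [bE dp m2 _]]].
rewrite /algC_reduced /disc /= m2; move: p0; move: (p : int) dp {bE m2} => q dp q0.
move=> /[swap] <-.
set E := b ^+ 2 - 4 * c; have D0 : 0 <= `|E| by [].
have ED : E <= `|E| by exact: ler_norm.
have bb : `|b| <= b ^+ 2 by nia.
have qq : 0 < q ^+ 2 by nia.
case=> [[b0 c0 cd]|[bq c0]|[b0 c0]].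
(* The inequality [c < d (b - d)] gives [b^2 - 4 c > b^2 - 4 d (b - d) = (b - 2 d)^2]. *)
- have b2d : (b - 2 * d) ^+ 2 <= `|E| by apply: le_trans ED; rewrite /E; nia.
  have bD : b <= `|E| + 2 * q by nia.
  have cD : c <= q * (`|E| + 2 * q) by nia.
  by split; nia.
- have b2 : b ^+ 2 <= q ^+ 2 by nia.
  have cD : c <= `|E| + q ^+ 2.
    have : - E <= `|E| by rewrite -normrN ler_norm.
    by rewrite {1}/E; nia.
  have h : 0 <= q * (`|E| + 2 * q) by nia.
  by split; nia.
have h : 0 <= q * (`|E| + 2 * q) by nia.
have b2 : b ^+ 2 + 4 * (- c) <= `|E| by apply: le_trans ED; rewrite /E; lia.
by split; lia.
Qed.

End Dynamics.

(** * The reduced sets of the three algorithms *)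

Section ReducedSets.
Context (p : nat) (p_pr : prime p).
Local Notation Qp := (padic p_pr).
Implicit Types (x : Qp) (bc : int * int).

(** Transfers the question to pairs. Both conditions may assume that the whole orbit stays in S,
    because its pairs are those of the iterates of a Hensel root. *)
Lemma reduced_setE alg (E : set (int * int)) : E `<=` setS p ->
  (forall bc l, (forall i, setS p (iter i (cfT_int p alg) bc)) -> (0 < l)%N ->
     iter l (cfT_int p alg) bc = bc -> E bc) ->
  (forall bc, (forall i, setS p (iter i (cfT_int p alg) bc)) -> E bc ->
     exists2 l, (0 < l)%N & iter l (cfT_int p alg) bc = bc) ->
  reduced_set p_pr alg = hensel_roots p_pr E.
Proof.
move=> ES perE Eper; apply/seteqP; split=> x.
  move=> /periodic_of_reduced[bc [l [xh l0 per]]].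
  have [_ x1 xP] := xh; split=> //; exists bc.
    by apply: perE per => // i; have [] := hensel_root_iter alg i xh.
  by rewrite hensel_polyE; apply/quad_poly_root; rewrite mul1r.
move=> [x1 [bc Ebc xP]]; have xh : hensel_root bc x.
  split=> //; first exact: ES.
  by move: xP; rewrite hensel_polyE => /quad_poly_root; rewrite mul1r.
have [|l l0 per] := Eper bc _ Ebc; last exact: reduced_of_periodic per.
by move=> i; have [] := hensel_root_iter alg i xh.
Qed.

Lemma setC_reducedE : setP1 p_pr `|` setR1 p `|` setS3 p `|` setS4 p =
  setS p `&` [set bc | algC_reduced p bc].
Proof.
have p0 : (0 : int) < p by rewrite ltz_nat prime_gt0.
(* The integral part of an integer is its residue modulo p, which turns the rational inequality of
   P_1 into one between integers. *)
have P1E (b c : int) :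
    ((c%:~R : rat) <
       int_part (b%:~R : Qp) * (b%:~R - int_part (b%:~R : Qp))) =
    (c < (b %% p)%Z * (b - (b %% p)%Z)).
  rewrite (@int_partE _ _ _ (b %% p)%Z).
  - by rewrite -rmorphB -rmorphM ltr_int.
  - by rewrite ltz_pmod // modz_ge0 // gt_eqF.
  rewrite -rmorphB; apply/pZp1_intrP.
  by rewrite -eqz_mod_dvd modz_mod.
apply/seteqP; split=> -[b c]; rewrite /setP1 /setR1 /setS1 /setS3 /setS4 /=.
  move=> [[[|]|]|].
  - by move=> [[[Sbc [b0 c0]] _]]; rewrite P1E => cd; split=> //; apply: Or31.
  - by move=> [[Sbc [b0 c0]] bp]; split=> //; apply: Or32.
  - by move=> [Sbc [b0 c0]]; split=> //; apply: Or33; rewrite lt_eqF.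
  by move=> [Sbc [b0 c0]]; split=> //; apply: Or33; rewrite gt_eqF.
move=> [Sbc [[/= b0 c0 cd]|[/= bp c0]|[/= b0 c0]]].
- have [bp|bp] := boolP (1 <= b <= p%:Z - 1).
    by left; left; right; do 2!split=> //.
  left; left; left; split; last by rewrite P1E.
  by split=> //= -[_]; apply/negP.
- left; left; right; split=> //; split=> //; split=> //.
  by case/andP: bp => b1 _; apply: lt_le_trans b1.
have [bn|bp] := ltP b 0; first by left; right.
by right; split=> //; split=> //; rewrite lt_neqAle eq_sym b0.
Qed.

Lemma reduced_setA : reduced_set p_pr AlgA = hensel_roots p_pr (setS p).
Proof.
apply: reduced_setE => // [bc l /(_ 0%N) //|bc _ _].
by exists 2%N => //=; rewrite /cfT_int /= T2_intK.
Qed.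

Lemma reduced_setB : reduced_set p_pr AlgB = hensel_roots p_pr (setR p).
Proof.
apply: reduced_setE => [bc []//|bc l S l0 per|bc _ [_ bp]]; last first.
  by exists 1%N; rewrite //= algB_fixed.
split; first exact: (S 0%N).
apply: (@periodic_absorbed _ (fun y => is_true (1 <= y.1 <= p%:Z - 1)) _ _ _ l0 per).
move=> i y; split=> [yR|nyR]; first by rewrite algB_fixed.
exact: (algB_step p_pr (S i) nyR).
Qed.

Lemma reduced_setC : reduced_set p_pr AlgC =
  hensel_roots p_pr (setP1 p_pr `|` setR1 p `|` setS3 p `|` setS4 p).
Proof.
rewrite setC_reducedE.
apply: reduced_setE => [bc []//|bc l S l0 per|bc S [_ Xbc]].
  split; first exact: (S 0%N).
  apply: (@periodic_absorbed _ (algC_reduced p) _ _ _ l0 per) => i y.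
  split=> [yX|nyX].
    exact: (algC_absorbing p_pr (S i) (S i.+1) yX).
  exact: (algC_step p_pr (S i) nyX).
have X i : algC_reduced p (iter i (cfT_int p AlgC) bc).
  elim: i => // i IHi.
  exact: (algC_absorbing p_pr (S i) (S i.+1) IHi).
have D i : disc (iter i (cfT_int p AlgC) bc) = disc bc.
  by elim: i => //= i <-; apply: disc_cfT.
have [N bnd] := algC_bounded p_pr (disc bc).
apply: (@periodic_of_bounded _ bc N) => [i y|i j].
  exact: (bnd _ (S i) (X i) (D i)).
exact: (algC_inj (X i) (X j)).
Qed.

End ReducedSets.

Unset Implicit Arguments.
Local Close Scope ring_scope.

Theorem theorem7p2 (p : nat) (p_pr : prime p) :
  [/\ reduced_set p_pr AlgA = hensel_roots p_pr (setS p),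
      reduced_set p_pr AlgB = hensel_roots p_pr (setR p)
    & reduced_set p_pr AlgC =
        hensel_roots p_pr (setP1 p_pr `|` setR1 p `|` setS3 p `|` setS4 p)].
Proof.
by split; [exact: reduced_setA | exact: reduced_setB | exact: reduced_setC].
Qed.
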